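(* Let $\mathcal F=\{f_i\}_{i\in I}$ be a $J$-frame for a Krein space $(\mathcal H,[\cdot,\cdot])$ with $J$-frame operator $S$ and $J$-frame bounds $0<\alpha_\pm\le\beta_\pm$. Assume also that $0<\gamma_\pm\le\delta_\pm$ are the $J$-frame bounds of its canonical dual $J$-frame $\mathcal F'=\{S^{-1}f_i\}_{i\in I}$. Then the spectrum of $S$ satisfies $$\sigma(S)\cap\mathbb R\subseteq[\varepsilon_-,\varepsilon_+],$$ $$\sigma(S)\setminus\mathbb R\subseteq\Bigl\{\lambda\in\mathbb C:\ \operatorname{Re}\lambda>\tfrac{\alpha}{2},\ \bigl|\lambda-\tfrac1\gamma\bigr|<\tfrac1\gamma\Bigr\},$$ where $$\varepsilon_-=\max\Bigl\{\min\bigl\{\tfrac1{\delta_+},\alpha_-\bigr\},\min\bigl\{\tfrac1{\delta_-},\alpha_+\bigr\}\Bigr\},\qquad \varepsilon_+=\min\Bigl\{\max\bigl\{\tfrac1{\gamma_+},\beta_-\bigr\},\max\bigl\{\tfrac1{\gamma_-},\beta_+\bigr\}\Bigr\},$$ $$\alpha=\max\{\alpha_+,\alpha_-\},\qquad \gamma=\max\{\gamma_+,\gamma_-\}.$$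
   Context: Krein spaces (over $\mathbb C$). A Krein space $(\mathcal H,[\cdot,\cdot])$ is a vector space with a Hermitian sesquilinear form admitting a fundamental decomposition $\mathcal H=\mathcal H_+\,[\dotplus]\,\mathcal H_-$, i.e. a direct, $[\cdot,\cdot]$-orthogonal sum such that $(\mathcal H_+,[\cdot,\cdot])$ and $(\mathcal H_-,-[\cdot,\cdot])$ are Hilbert spaces. The associated Hilbert inner product is $\langle x_++x_-,y_++y_-\rangle=[x_+,y_+]-[x_-,y_-]$; the norms coming from different fundamental decompositions are equivalent, so the topology of $\mathcal H$ is independent of the choice. $\mathcal M^{[\perp]}=\{x:[x,m]=0\ \forall m\in\mathcal M\}$. A subspace $\mathcal L$ is uniformly positive (negative) if there is $\alpha>0$ with $[x,x]\ge\alpha\|x\|^2$ (resp. $-[x,x]\ge\alpha\|x\|^2$) for all $x\in\mathcal L$; maximal means maximal with respect to inclusion among such subspaces. $J$-frames. A family $\mathcal F=\{f_i\}_{i\in I}$ in $\mathcal H$ is a Bessel family if $\sum_{i\in I}|\langle f,f_i\rangle|^2\le\beta\|f\|^2$ for all $f$, for some $\beta<\infty$. Its synthesis operator is the bounded operator $T:\ell_2(I)\to\mathcal H$, $Tx=\sum_{i\in I}x_if_i$. Put $I_+=\{i:[f_i,f_i]\ge0\}$, $I_-=\{i:[f_i,f_i]<0\}$, $T_\pm x=\sum_{i\in I_\pm}x_if_i$, and $\mathcal M_\pm=\overline{\operatorname{span}\{f_i:i\in I_\pm\}}$. $\mathcal F$ is a $J$-frame for $\mathcal H$ if the range $R(T_+)$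 is a maximal uniformly positive subspace and $R(T_-)$ is a maximal uniformly negative subspace of $\mathcal H$ (then $R(T_\pm)=\mathcal M_\pm$). The $J$-frame operator of $\mathcal F$ is $Sf=\sum_{i\in I_+}[f,f_i]f_i-\sum_{i\in I_-}[f,f_i]f_i$; it is bounded, boundedly invertible and self-adjoint in the Krein space. $J$-frame bounds. The $J$-frame bounds of $\mathcal F$ are the optimal constants (largest $\alpha_\pm$, smallest $\beta_\pm$) in $\alpha_\pm(\pm[f,f])\le\sum_{i\in I_\pm}|[f,f_i]|^2\le\beta_\pm(\pm[f,f])$ for every $f\in\mathcal M_\pm$. Canonical dual. $\mathcal F'=\{S^{-1}f_i\}_{i\in I}$ is also a $J$-frame for $\mathcal H$, with the same index sets $I_\pm$, with $J$-frame operator $S^{-1}$, and with $\overline{\operatorname{span}\{S^{-1}f_i:i\in I_\pm\}}=\mathcal M_\mp^{[\perp]}$. Its $J$-frame bounds are the optimal constants in $\gamma_\pm(\pm[f,f])\le\sum_{i\in I_\pm}|[f,S^{-1}f_i]|^2\le\delta_\pm(\pm[f,f])$ for every $f\in\mathcal M_\mp^{[\perp]}$. *)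

(* Defs.v *)
From HB Require Import structures.
From mathcomp Require Import all_boot all_order all_algebra finmap.
From mathcomp Require Import complex.
From mathcomp Require Import all_classical all_reals all_analysis.
From mathcomp Require Import ring.
From mathcomp.analysis.showcase Require summability.

Set Implicit Arguments.
Unset Strict Implicit.
Unset Printing Implicit Defensive.
Import Order.TTheory GRing.Theory Num.Theory.
Import numFieldNormedType.Exports.
Local Open Scope classical_set_scope.
Local Open Scope ring_scope.
Local Open Scope complex_scope.

Section Hilbert_subspace.
Variables (K : numFieldType) (V : lmodType K).
Implicit Types (L : set V) (b : V -> V -> K).

Definition linear_subspace L :=
  L 0 /\ forall (a : K) x y, L x -> L y -> L (a *: x + y).

Definition linear_span (X : set V) : set V :=
  [set x | exists n (c : 'I_n -> K) (v : 'I_n -> V),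
     (forall k, X (v k)) /\ x = \sum_(k < n) c k *: v k].

(* (L, b) is a Hilbert space; b is assumed to be Hermitian sesquilinear.  *)
Definition hilbert_subspace L b :=
  [/\ linear_subspace L,
      forall x, L x -> x != 0 -> 0 < b x x &
      forall u : nat -> V, (forall n, L (u n)) ->
        (forall e : K, 0 < e -> exists N, forall m n, (N <= m)%N -> (N <= n)%N ->
           b (u m - u n) (u m - u n) < e) ->
        exists2 l, L l &
          forall e : K, 0 < e -> exists N, forall n, (N <= n)%N ->
            b (u n - l) (u n - l) < e].

End Hilbert_subspace.

Section Fundamental_decomposition.
Variables (C : numClosedFieldType) (V : lmodType C).
Variable (form : {hermitian_sym V for Num.conj}).

Definition fundamental_decomposition (Vp Vm : set V) :=
  [/\ hilbert_subspace Vp form,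
      hilbert_subspace Vm (fun x y => - form x y),
      forall x y, Vp x -> Vm y -> form x y = 0,
      Vp `&` Vm = [set 0] &
      forall x, exists2 y, Vp y & Vm (x - y)].

End Fundamental_decomposition.

Record kreinSpace (R : realType) := KreinSpace {
  krein_lmod : lmodType R[i];
  krein_form : {hermitian_sym krein_lmod for Num.conj};
  krein_dec : exists Vp Vm, fundamental_decomposition krein_form Vp Vm }.

Definition krein_sort (R : realType) (H : kreinSpace R) : Type := krein_lmod H.
Coercion krein_sort : kreinSpace >-> Sortclass.

HB.instance Definition _ (R : realType) (H : kreinSpace R) :=
  GRing.Lmodule.copy (krein_sort H) (krein_lmod H).

Definition kform (R : realType) (H : kreinSpace R) (x y : H) : R[i] :=
  krein_form H x y.

(* The norm of a Krein space is the Hilbert norm of a fundamental           *)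
(* decomposition picked by choice; only its topology and the notions that   *)
(* are invariant under equivalence of norms are used.                       *)
Section Krein_norm.
Variables (R : realType) (H : kreinSpace R).
Implicit Types (x y z : H) (a : R[i]).

Local Notation "''[' x , y ]" := (kform x y) : ring_scope.

Definition krein_pos : set H := projT1 (cid (krein_dec H)).
Definition krein_neg : set H := projT1 (cid (projT2 (cid (krein_dec H)))).

Lemma krein_posnegP :
  fundamental_decomposition (krein_form H) krein_pos krein_neg.
Proof. by rewrite /krein_pos /krein_neg; case: (cid (krein_dec H)) => Vp VpP /=; case: cid. Qed.

Definition krein_projp x : H := xget 0 [set y | krein_pos y /\ krein_neg (x - y)].
Definition krein_projm x : H := x - krein_projp x.

Definition krein_inner x y : R[i] :=
  '[krein_projp x, krein_projp y] - '[krein_projm x, krein_projm y].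

Definition krein_norm x : R[i] := sqrtC (krein_inner x x).

Lemma kformDl x y z : '[x + y, z] = '[x, z] + '[y, z].
Proof. exact: linearDl. Qed.

Lemma kformZl a x z : '[a *: x, z] = a * '[x, z].
Proof. exact: linearZl_LR. Qed.

Lemma kformC x y : '[x, y] = Num.conj '[y, x].
Proof. by rewrite /kform hermC /= expr0 mul1r. Qed.

Lemma krein_projpP x : krein_pos (krein_projp x) /\ krein_neg (krein_projm x).
Proof.
have [_ _ _ _ /(_ x) [y py ny]] := krein_posnegP.
by rewrite /krein_projm /krein_projp; case: xgetP => [z _ //|/(_ y)]; case.
Qed.

Lemma krein_proj_uniq x y z :
  krein_pos y -> krein_neg z -> x = y + z -> krein_projp x = y.
Proof.
move=> py nz ->; have [p n] := krein_projpP (y + z).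
have [[[_ lp] _ _] [[_ ln] _ _] _ I0 _] := krein_posnegP.
suff : (krein_pos `&` krein_neg) (krein_projp (y + z) - y).
  by rewrite I0 => /eqP; rewrite subr_eq0 => /eqP.
split; first by rewrite addrC -scaleN1r; exact: lp.
have -> : krein_projp (y + z) - y = -1 *: krein_projm (y + z) + z.
  by rewrite scaleN1r /krein_projm opprB -addrA opprD subrK.
exact: ln.
Qed.

Lemma krein_projpL a x y :
  krein_projp (a *: x + y) = a *: krein_projp x + krein_projp y.
Proof.
have [px nx] := krein_projpP x; have [py ny] := krein_projpP y.
have [[[_ lp] _ _] [[_ ln] _ _] _ _ _] := krein_posnegP.
apply: (@krein_proj_uniq _ _ (a *: krein_projm x + krein_projm y)).
- exact: lp.
- exact: ln.
- by rewrite addrACA -scalerDr /krein_projm !subrKC.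
Qed.

Lemma krein_projmL a x y :
  krein_projm (a *: x + y) = a *: krein_projm x + krein_projm y.
Proof. by rewrite /krein_projm krein_projpL scalerBr opprD addrACA. Qed.

Lemma krein_innerL a x y z :
  krein_inner (a *: x + y) z = a * krein_inner x z + krein_inner y z.
Proof.
rewrite /krein_inner krein_projpL krein_projmL.
rewrite (kformDl _ (krein_projp y)) (kformDl _ (krein_projm y)) !kformZl.
by rewrite opprD addrACA mulrBr.
Qed.

Lemma krein_innerC x y : krein_inner x y = Num.conj (krein_inner y x).
Proof. by rewrite /krein_inner rmorphB /= -!kformC. Qed.

Lemma krein_innerDl x y z :
  krein_inner (x + y) z = krein_inner x z + krein_inner y z.
Proof. by have := krein_innerL 1 x y z; rewrite scale1r mul1r. Qed.

Lemma krein_inner0l z : krein_inner 0 z = 0.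
Proof.
by have := krein_innerDl 0 0 z; rewrite addr0 => /eqP; rewrite -subr_eq subrr
  eq_sym => /eqP.
Qed.

Lemma krein_innerZl a x z : krein_inner (a *: x) z = a * krein_inner x z.
Proof. by have := krein_innerL a x 0 z; rewrite krein_inner0l !addr0. Qed.

Lemma krein_innerDr x y z :
  krein_inner z (x + y) = krein_inner z x + krein_inner z y.
Proof. by rewrite krein_innerC krein_innerDl rmorphD /= -!krein_innerC. Qed.

Lemma krein_innerZr a x z :
  krein_inner z (a *: x) = Num.conj a * krein_inner z x.
Proof. by rewrite krein_innerC krein_innerZl rmorphM /= -krein_innerC. Qed.

Lemma kform_pos_ge0 x : krein_pos x -> 0 <= '[x, x] ?= iff (x == 0).
Proof.
have [[_ pp _] _ _ _ _] := krein_posnegP => px.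
have [->|x0] := eqVneq x 0; first by rewrite /kform linear0l; exact/leif_refl.
by apply/leifP; exact: pp.
Qed.

Lemma kform_neg_ge0 x : krein_neg x -> 0 <= - '[x, x] ?= iff (x == 0).
Proof.
have [_ [_ pp _] _ _ _] := krein_posnegP => px.
have [->|x0] := eqVneq x 0; first by rewrite /kform linear0l oppr0; exact/leif_refl.
by apply/leifP; exact: pp.
Qed.

Lemma krein_inner_ge0 x : 0 <= krein_inner x x.
Proof.
have [px nx] := krein_projpP x.
by rewrite addr_ge0 ?(kform_pos_ge0 px) ?(kform_neg_ge0 nx).
Qed.

Lemma krein_inner_eq0 x : krein_inner x x = 0 -> x = 0.
Proof.
have [px nx] := krein_projpP x => /eqP.
rewrite paddr_eq0 ?(kform_pos_ge0 px) ?(kform_neg_ge0 nx)// => /andP[].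
rewrite eq_sym (kform_pos_ge0 px) => /eqP p0.
rewrite eq_sym (kform_neg_ge0 nx) => /eqP.
by rewrite /krein_projm p0 subr0.
Qed.

Lemma krein_CauchySchwarz x y :
  `|krein_inner x y| <= krein_norm x * krein_norm y.
Proof.
rewrite /krein_norm -sqrtCM ?nnegrE ?krein_inner_ge0//.
rewrite -[leLHS]sqrCK// ler_sqrtC ?nnegrE ?exprn_ge0 ?mulr_ge0 ?krein_inner_ge0//.
have [->|y0] := eqVneq y 0.
  by rewrite krein_inner0l mulr0 krein_innerC krein_inner0l rmorph0 normr0 expr0n.
have yy : 0 < krein_inner y y.
  by rewrite lt_def krein_inner_ge0 andbT; apply: contra_neq y0 => /krein_inner_eq0.
have := krein_inner_ge0 (krein_inner y y *: x + - krein_inner x y *: y).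
rewrite !(krein_innerDl, krein_innerDr, krein_innerZl, krein_innerZr).
rewrite rmorphN /= -!krein_innerC normCK -krein_innerC.
set a := krein_inner x x; set b := krein_inner y y.
set c := krein_inner x y; set d := krein_inner y x.
have -> : b * (b * a + - d * c) + (b * (- c * d) + - c * (- d * b)) =
  b * (a * b - c * d) by ring.
by rewrite pmulr_rge0// subr_ge0.
Qed.

Lemma krein_normD x y : krein_norm (x + y) <= krein_norm x + krein_norm y.
Proof.
have n0 z : 0 <= krein_norm z by rewrite sqrtC_ge0 krein_inner_ge0.
rewrite -ler_sqr ?nnegrE ?addr_ge0// sqrrD !sqrtCK.
have -> : krein_inner (x + y) (x + y) = krein_inner x x +
    (krein_inner x y + Num.conj (krein_inner x y)) + krein_inner y y.
  by rewrite -krein_innerC krein_innerDl !krein_innerDr !addrA.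
rewrite lerD2r lerD2l; set c := krein_inner x y.
have -> : c + Num.conj c = 'Re c *+ 2.
  by rewrite ReE -mulr_natr mulfVK ?pnatr_eq0.
rewrite lerMn2r orFb; apply: le_trans (krein_CauchySchwarz x y).
by rewrite (leif_Re_Creal c).
Qed.

Lemma krein_normZ a x : krein_norm (a *: x) = `|a| * krein_norm x.
Proof.
rewrite /krein_norm krein_innerZl krein_innerZr mulrA -normCK.
by rewrite sqrtCM ?nnegrE ?exprn_ge0 ?krein_inner_ge0// sqrCK.
Qed.

Lemma krein_norm_eq0 x : krein_norm x = 0 -> x = 0.
Proof. by move/eqP; rewrite sqrtC_eq0 => /eqP/krein_inner_eq0. Qed.

End Krein_norm.

HB.instance Definition _ (R : realType) (H : kreinSpace R) :=
  Lmodule_isNormed.Build R[i] (krein_sort H)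
    (@krein_normD R H) (@krein_normZ R H) (@krein_norm_eq0 R H).

Section Operators.
Variables (K : numFieldType) (V : normedModType K).

Definition resolvent_set (T : V -> V) : set K :=
  [set l | exists B : {linear V -> V},
     [/\ continuous B, cancel (fun x => T x - l *: x) B
       & cancel B (fun x => T x - l *: x)]].

Definition spectrum (T : V -> V) : set K := ~` resolvent_set T.

(* Unconditional sum of u over A, as a limit over the finite subsets.  *)
Definition usum (I : choiceType) (A : set I) (u : I -> V) : V :=
  summability.sum (fun i => if i \in A then u i else 0).

End Operators.

Section J_frames.
Variables (R : realType) (H : kreinSpace R) (I : choiceType).
Implicit Types (F : I -> H) (L : set H) (A : set I).

Local Notation "''[' x , y ]" := (kform x y) : ring_scope.

(* Order on R[i]: z <= w means that w - z is real and nonnegative.  *)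
Definition uniformly_positive L := linear_subspace L /\
  exists2 a : R, 0 < a & forall x, L x -> a%:C * `|x| ^+ 2 <= '[x, x].

Definition uniformly_negative L := linear_subspace L /\
  exists2 a : R, 0 < a & forall x, L x -> a%:C * `|x| ^+ 2 <= - '[x, x].

Definition maximal_subspace (P : set H -> Prop) L :=
  P L /\ forall L', P L' -> L `<=` L' -> L' = L.

Definition sqmod (z : R[i]) : R := (Normc.normc z) ^+ 2.

Definition bessel F := exists b : R, forall f : H,
  (\esum_(i in [set: I]) (sqmod (krein_inner f (F i)))%:E
     <= (b * complex.Re (`|f| ^+ 2))%:E)%E.

Definition ell2 : set (I -> R[i]) :=
  [set x | (\esum_(i in [set: I]) (sqmod (x i))%:E < +oo)%E].

Definition idx_pos F : set I := [set i | 0 <= '[F i, F i]].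
Definition idx_neg F : set I := [set i | '[F i, F i] < 0].

Definition synthesis F A (x : I -> R[i]) : H := usum A (fun i => x i *: F i).

Definition closed_span F A : set H := closure (linear_span (F @` A)).

Definition Jframe F :=
  [/\ bessel F,
      maximal_subspace uniformly_positive (synthesis F (idx_pos F) @` ell2) &
      maximal_subspace uniformly_negative (synthesis F (idx_neg F) @` ell2)].

Definition Jframe_op F (f : H) : H :=
  usum (idx_pos F) (fun i => '[f, F i] *: F i)
  - usum (idx_neg F) (fun i => '[f, F i] *: F i).

Definition canonical_dual F (i : I) : H :=
  'pinv_(fun=> 0) [set: H] (Jframe_op F) (F i).

(* a is the largest and b the smallest constant such that                   *)
(*   a q(f) <= \sum_(i in A) |[f, F i]|^2 <= b q(f)                           *)
(* on closed_span F A. No such a, b exist when q vanishes identically there.  *)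
Definition optimal_bounds F A (q : H -> R) (a b : R) :=
  let lower := [set c : R | forall f, closed_span F A f ->
    ((c * q f)%:E <= \esum_(i in A) (sqmod '[f, F i])%:E)%E] in
  let upper := [set c : R | forall f, closed_span F A f ->
    (\esum_(i in A) (sqmod '[f, F i])%:E <= (c * q f)%:E)%E] in
  [/\ lower a, ubound lower a, upper b & lbound upper b].

Definition Jframe_bounds F (ap bp am bm : R) :=
  optimal_bounds F (idx_pos F) (fun f => complex.Re '[f, f]) ap bp /\
  optimal_bounds F (idx_neg F) (fun f => - complex.Re '[f, f]) am bm.

End J_frames.

Definition real_line (R : realType) : set R[i] := range (fun r : R => r%:C).

Arguments real_line R : clear implicits.

(* Main.v *)
Require Import Defs.
From HB Require Import structures.
From mathcomp Require Import all_boot all_order all_algebra finmap.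
From mathcomp Require Import complex.
From mathcomp Require Import all_classical all_reals all_analysis.
From mathcomp Require Import ring lra.
From mathcomp.analysis.showcase Require summability.

Set Implicit Arguments.
Unset Strict Implicit.
Unset Printing Implicit Defensive.
Import Order.TTheory GRing.Theory Num.Theory.
Import numFieldNormedType.Exports.
Local Open Scope classical_set_scope.
Local Open Scope ring_scope.
Local Open Scope complex_scope.

(** Write U1 f and U2 f for the sums of [f, f_i] f_i over the indices of positive and
    of negative type, so that S = U1 - U2, and M1, M2 for the ranges of the two
    synthesis operators. By symmetry of U1 and U2, the kernels are the orthogonal
    companions N- = ker U1 of M1 and N+ = ker U2 of M2. The operator S maps N+ onto M1
    and N- onto M2, so that [S h, y] = [S y, h] = 0 for h in N+ and y in N-. Put

      p = [h, h], a = [S h, h], P = [S h, S h],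
      q = - [y, y], d = - [S y, y], Q = - [S y, S y];

    all six are nonnegative. The bounds of the frame give ap p <= a and ap a <= P
    (kernel_lower_bound, range_lower_bound); those of the dual frame, whose analysis
    sum at the projection of S h onto N+ is again a (dual_vector), give
    gp a <= p <= dp a (dual_lower_bound, dual_upper_bound). The same holds for the
    negative side.

    Let S f = l f with f = h + y and c = [y, h]. Pairing with h and with y gives
    a = l (p + c) and d = l (q - conj c). If l is real then a + d = l (p + q), which
    puts l above the smaller of the lower bounds for a / p and d / q. The upper bound
    for l comes from the decomposition f = h + m with h in N+ and m in M2, which is
    orthogonal; the two choices of signs account for the max and min in the theorem. If
    l is not real then a = d and p + q = 2 Re (1 / l) a, and gp a <= p forces
    2 Re (1 / l) > gp, which is the disc condition. Pairing with S h and S y instead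
    gives P + Q = 2 a Re l, and ap a <= P forces Re l > ap / 2.

    Since the spectrum does not consist of eigenvalues only, these computations are
    made quantitative: outside the claimed region S - l is bounded below
    (bounded_below_real_lt, bounded_below_real_gt, pair_bounded_below). The region is
    stable under conjugation, so the Krein adjoint of S - l is bounded below too, and
    the Lax-Milgram lemma applied to the product of S - l with its Hilbert adjoint shows
    that S - l is onto (surjective_of_bounded_below, resolvent_of_bounded_below).

    The geometry behind the decompositions rests on the maximality of M1 and M2:
    they are closed, and N-, N+ are uniformly definite of the opposite sign
    (side_closed, side_ker_definite). Consequently S is invertible
    (frame_op_bounded_below) and the space is the sum of N+ and N-
    (frame_op_kernels). To treat both signs at once, most lemmas concern the form
    s [.,.] with s = 1 or -1. *)

(** * Real and complex scalars *)

Section Scalars.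
Variable R : realType.

Lemma ler_of_sqr (k x y : R) : 0 <= x -> 0 <= y ->
  (k * x) ^+ 2 <= x * y -> k ^+ 2 * x <= y.
Proof.
move=> x0 y0; have [->|xn] := eqVneq x 0; first by rewrite !mulr0.
have xp : 0 < x by rewrite lt_def xn.
by rewrite exprMn expr2 mulrA (mulrC x) ler_pM2r// -expr2.
Qed.

Lemma ReD (a b : R[i]) : complex.Re (a + b) = complex.Re a + complex.Re b.
Proof. by case: a; case: b. Qed.

Lemma ReN (a : R[i]) : complex.Re (- a) = - complex.Re a.
Proof. by case: a. Qed.

Lemma ReZ (t : R) (a : R[i]) : complex.Re (t%:C * a) = t * complex.Re a.
Proof. by case: a => a b /=; rewrite mul0r subr0. Qed.

Lemma ReJ (a : R[i]) : complex.Re (Num.conj a) = complex.Re a.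
Proof. by case: a. Qed.

Lemma ImJ (a : R[i]) : complex.Im (Num.conj a) = - complex.Im a.
Proof. by case: a. Qed.

Lemma sqmod_ge0 (a : R[i]) : 0 <= sqmod a.
Proof. exact: sqr_ge0. Qed.

Lemma sqmodE (a : R[i]) : sqmod a = complex.Re a ^+ 2 + complex.Im a ^+ 2.
Proof. by case: a => a b; rewrite /sqmod /= sqr_sqrtr// addr_ge0 ?sqr_ge0. Qed.

Lemma normC_sqmod (a : R[i]) : `|a| ^+ 2 = (sqmod a)%:C.
Proof. by rewrite -add_Re2_Im2 sqmodE. Qed.

Lemma Re_mulJ_le (t : R) (a b : R[i]) : 0 < t ->
  complex.Re (a * Num.conj b) <= t / 2 * sqmod a + (2 * t)^-1 * sqmod b.
Proof.
move=> t0; rewrite !sqmodE; case: a => a a'; case: b => b b' /=.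
have -> : a * b - a' * - b' = a * b + a' * b' by ring.
have : 0 <= ((t * a - b) ^+ 2 + (t * a' - b') ^+ 2) * (2 * t)^-1.
  by rewrite mulr_ge0 ?addr_ge0 ?sqr_ge0// invr_ge0 mulr_ge0 ?(ltW t0).
have -> : ((t * a - b) ^+ 2 + (t * a' - b') ^+ 2) * (2 * t)^-1 =
  (t / 2 * (a ^+ 2 + a' ^+ 2) + (2 * t)^-1 * (b ^+ 2 + b' ^+ 2)) - (a * b + a' * b').
  by field; rewrite gt_eqF.
by rewrite subr_ge0.
Qed.

Lemma sqmod_norm_lt (z : R[i]) (t : R) : 0 < t ->
  (`|z| < t%:C) = (sqmod z < t ^+ 2).
Proof.
move=> t0; rewrite -(ltr_pXn2r (n := 2)) ?nnegrE ?normr_ge0 ?ler0c ?(ltW t0)//.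
by rewrite normC_sqmod -rmorphXn ltcR.
Qed.

(** The complement of the disc of centre and radius 1 / t is the inverse image of a
    half-plane under inversion. *)
Lemma Re_inv_le (z : R[i]) (t : R) : complex.Im z != 0 -> 0 < t ->
  t^-1 ^+ 2 <= sqmod (z - (t^-1)%:C) -> 2 * complex.Re z^-1 <= t.
Proof.
rewrite sqmodE; case: z => x y /= y0 t0; rewrite oppr0 addr0 => h.
have n0 : 0 < x ^+ 2 + y ^+ 2.
  by rewrite ltr_wpDl ?sqr_ge0// exprn_even_gt0.
rewrite mulrA ler_pdivrMr//.
have : t * t^-1 ^+ 2 <= t * ((x - t^-1) ^+ 2 + y ^+ 2) by rewrite ler_wpM2l// ltW.
have -> : t * ((x - t^-1) ^+ 2 + y ^+ 2) =
  t * (x ^+ 2 + y ^+ 2) - 2 * x + t * t^-1 ^+ 2 by field; rewrite gt_eqF.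
lra.
Qed.

End Scalars.

(** * Real symmetric forms and the Lax-Milgram lemma *)

Section Symmetric_forms.
Variables (R : realType) (V : lmodType R[i]).
Implicit Types (B : V -> V -> R) (L : set V).

(** The real parts of Hermitian forms: homogeneity is asked for real scalars only,
    which keeps complex conjugation out of all estimates. *)
Record symform B : Prop := SymForm {
  symformC : forall x y, B x y = B y x;
  symformDl : forall x y z, B (x + y) z = B x z + B y z;
  symformZl : forall (t : R) x z, B (t%:C *: x) z = t * B x z }.

Definition hilbertian L B :=
  [/\ linear_subspace L,
      forall x, L x -> 0 <= B x x,
      forall x, L x -> B x x = 0 -> x = 0 &
      forall u : nat -> V, (forall n, L (u n)) ->
        (forall e : R, 0 < e -> exists N, forall m n, (N <= m)%N -> (N <= n)%N ->
           B (u m - u n) (u m - u n) < e) ->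
        exists2 l, L l &
          forall e : R, 0 < e -> exists N, forall n, (N <= n)%N ->
            B (u n - l) (u n - l) < e].

Section Theory.
Variable B : V -> V -> R.
Hypothesis hB : symform B.

Lemma symformDr x y z : B z (x + y) = B z x + B z y.
Proof. by rewrite symformC// symformDl// !(symformC hB z). Qed.

Lemma symformZr (t : R) x z : B z (t%:C *: x) = t * B z x.
Proof. by rewrite symformC// symformZl// (symformC hB z). Qed.

Lemma symformNl x z : B (- x) z = - B x z.
Proof. by have := symformZl hB (-1) x z; rewrite rmorphN1 scaleN1r mulN1r. Qed.

Lemma symformNr x z : B z (- x) = - B z x.
Proof. by rewrite symformC// symformNl (symformC hB z). Qed.

Lemma symform0l z : B 0 z = 0.
Proof. by have := symformZl hB 0 0 z; rewrite scaler0 mul0r. Qed.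

Lemma symform0r z : B z 0 = 0.
Proof. by rewrite symformC// symform0l. Qed.

Definition symformE := (symformDr, symformZr, symformNr, symformDl hB, symformZl hB, symformNl).

Lemma symform_sqrD x y : B (x + y) (x + y) = B x x + 2 * B x y + B y y.
Proof. by rewrite !symformE (symformC hB y x); ring. Qed.

Lemma symform_sqrB x y : B (x - y) (x - y) = B x x - 2 * B x y + B y y.
Proof. by rewrite !symformE (symformC hB y x); ring. Qed.

(** The discriminant of the nonnegative polynomial t |-> B (x - t y) (x - t y);
    the form need not be definite, so B y y = 0 is a separate case. *)
Lemma symform_CauchySchwarz L x y : linear_subspace L ->
  (forall z, L z -> 0 <= B z z) -> L x -> L y ->
  (B x y) ^+ 2 <= B x x * B y y.
Proof.
move=> [L0 LL] pos Lx Ly.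
have P (t : R) : 0 <= B x x - 2 * t * B x y + t ^+ 2 * B y y.
  have Lz : L ((- t)%:C *: y + x) by exact: LL.
  have := pos _ Lz; rewrite !symformE (symformC hB y x).
  by move=> h; apply: le_trans h _; rewrite le_eqVlt; apply/orP; left; apply/eqP; ring.
have yy := pos y Ly.
have [y0|y0] := eqVneq (B y y) 0.
  rewrite y0 mulr0; have [->|xy0] := eqVneq (B x y) 0; first by rewrite expr0n.
  have := P ((B x x + 1) / (2 * B x y)); rewrite y0 mulr0 addr0.
  have -> : 2 * ((B x x + 1) / (2 * B x y)) * B x y = B x x + 1.
    by field; rewrite xy0.
  lra.
have ypos : 0 < B y y by rewrite lt_def y0.
have := P (B x y / B y y).
have -> : B x x - 2 * (B x y / B y y) * B x y + (B x y / B y y) ^+ 2 * B y y =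
  (B x x * B y y - (B x y) ^+ 2) / B y y by field.
by rewrite pmulr_lge0 ?invr_gt0// subr_ge0.
Qed.

End Theory.

(** Richardson iteration: for a small step s, the map e |-> e - s T e contracts
    the B-norm, so that the iterates x(n+1) = x(n) + s (y - T x(n)) converge to a
    solution of T x = y. *)
Lemma Lax_Milgram L B (T : V -> V) (C c : R) : symform B -> hilbertian L B ->
  (forall a x y, T (a *: x + y) = a *: T x + T y) ->
  (forall x, L x -> L (T x)) ->
  0 < c -> (forall x, L x -> c * B x x <= B (T x) x) ->
  (forall x, L x -> B (T x) (T x) <= C * B x x) ->
  forall y, L y -> exists2 x, L x & T x = y.
Proof.
move=> hB [[L0 LL] pos def cpl] TL LT c0 coer bnd y Ly.
pose D := Num.max C (c ^+ 2 + 1).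
have D0 : 0 < D by rewrite lt_max; apply/orP; right; rewrite ltr_wpDl ?sqr_ge0.
have cD : c ^+ 2 < D by rewrite lt_max ltrDl ltr01 orbT.
pose s := c / D; have s0 : 0 < s by rewrite divr_gt0.
pose k := 1 - c ^+ 2 / D.
have k1 : k < 1 by rewrite /k ltrBlDr ltrDl divr_gt0// exprn_gt0.
have k0 : 0 < k by rewrite /k subr_gt0 ltr_pdivrMr// mul1r.
pose G x := x - s%:C *: T x.
have LB x z : L x -> L z -> L (x - z).
  by move=> Lx Lz; rewrite addrC -scaleN1r; exact: LL.
have LD x z : L x -> L z -> L (x + z).
  by move=> Lx Lz; have := LL 1 x z Lx Lz; rewrite scale1r.
have LZ a x : L x -> L (a *: x).
  by move=> Lx; have := LL a x 0 Lx L0; rewrite addr0.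
have LG x : L x -> L (G x) by move=> Lx; apply: LB => //; apply/LZ/LT.
have GB x z : G (x - z) = G x - G z.
  rewrite /G.
  have -> : T (x - z) = T x - T z.
    by rewrite -scaleN1r addrC TL scaleN1r addrC.
  by rewrite scalerBr !opprD addrACA.
have Gk x : L x -> B (G x) (G x) <= k * B x x.
  move=> Lx; rewrite /G symform_sqrB// !(symformE hB) (symformC hB x).
  have h1 := coer x Lx; have h2 := bnd x Lx; have h3 := pos x Lx.
  have h4 : B (T x) (T x) <= D * B x x.
    by apply: le_trans h2 _; rewrite ler_wpM2r// le_max lexx.
  have : s * (c * B x x) <= s * B (T x) x by rewrite ler_wpM2l// ltW.
  have : s * (s * B (T x) (T x)) <= s * (s * (D * B x x)).
    by do 2! (rewrite ler_wpM2l ?(ltW s0)//).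
  have -> : s * (s * (D * B x x)) = c ^+ 2 / D * B x x by rewrite /s; field; rewrite gt_eqF.
  have -> : s * (c * B x x) = c ^+ 2 / D * B x x by rewrite /s; field; rewrite gt_eqF.
  rewrite /k; lra.
pose u := fix u n := if n is n'.+1 then G (u n') + s%:C *: y else 0.
have Lu n : L (u n).
  by elim: n => [//|n IH] /=; apply: LD; [exact: LG|exact: LZ].
(* B (v + w) (v + w) <= (1 + h) B v v + (1 + 1 / h) B w w for h > 0 *)
have young h v w : 0 < h -> L v -> L w ->
    B (v + w) (v + w) <= (1 + h) * B v v + (1 + h^-1) * B w w.
  move=> h0 Lv Lw; rewrite symform_sqrD//.
  have : 0 <= h^-1 * B (h%:C *: v - w) (h%:C *: v - w).
    by rewrite mulr_ge0 ?invr_ge0 ?(ltW h0)//; apply/pos/LB => //; exact: LZ.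
  rewrite symform_sqrB// !(symformE hB).
  have -> : h^-1 * (h * (h * B v v) - 2 * (h * B v w) + B w w) =
     h * B v v - 2 * B v w + h^-1 * B w w by field; rewrite gt_eqF.
  lra.
pose h := (k^-1 - 1) / 2.
have h0 : 0 < h by rewrite divr_gt0 ?ltr0n// subr_gt0 invf_gt1.
pose k' := (1 + h) * k.
have k'E : k' = (1 + k) / 2 by rewrite /k' /h mulrDl; field; rewrite gt_eqF.
have k'1 : k' < 1 by rewrite k'E; lra.
pose E := (1 + h^-1) * (s ^+ 2 * B y y) / (1 - k').
have E0 : 0 <= E.
  rewrite /E divr_ge0 ?subr_ge0 ?(ltW k'1)// mulr_ge0 ?addr_ge0 ?invr_ge0 ?(ltW h0)//.
  by rewrite mulr_ge0 ?sqr_ge0 ?pos.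
have uE n : B (u n) (u n) <= E.
  elim: n => [|n IH] /=; first by rewrite symform0l.
  apply: le_trans (young h _ _ h0 _ _) _; [exact: LG|exact: LZ|].
  rewrite [B (s%:C *: y) _]symformZl// [B y _]symformZr//.
  have -> : E = k' * E + (1 + h^-1) * (s * (s * B y y)).
    rewrite /E; field; by rewrite subr_eq0 gt_eqF// gt_eqF//.
  rewrite lerD2r /k' -mulrA ler_wpM2l ?addr_ge0 ?(ltW h0)//.
  by apply: le_trans (Gk _ (Lu n)) _; rewrite ler_wpM2l ?(ltW k0).
have uB n p : B (u (n + p)%N - u n) (u (n + p)%N - u n) <= k ^+ n * E.
  elim: n => [|n IH]; first by rewrite add0n subr0 expr0 mul1r; exact: uE.
  rewrite addSn /= opprD addrACA subrr addr0 -GB.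
  apply: le_trans (Gk _ (LB _ _ (Lu _) (Lu _))) _.
  by rewrite exprS -mulrA ler_wpM2l ?(ltW k0).
have kn (e : R) : 0 < e -> exists N, forall n, (N <= n)%N -> k ^+ n * E < e.
  move=> e0; have : k ^+ n @[n --> \oo] --> (0 : R).
    by apply: cvg_expr; rewrite ger0_norm ?(ltW k0).
  move=> /cvgrPdist_lt /(_ (e / (E + 1))) [].
    by rewrite divr_gt0// ltr_wpDl.
  move=> N _ hN; exists N => n /hN /=.
  rewrite sub0r normrN ger0_norm ?exprn_ge0 ?(ltW k0)// ltr_pdivlMr; last lra.
  by apply: le_lt_trans; rewrite ler_wpM2l ?exprn_ge0 ?(ltW k0)//; lra.
have [l Ll ul] : exists2 l, L l & forall e : R, 0 < e -> exists N, forall n,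
    (N <= n)%N -> B (u n - l) (u n - l) < e.
  apply: cpl => // e e0; have [N hN] := kn _ e0; exists N => m n Nm Nn.
  wlog mn : m n Nm Nn / (n <= m)%N.
    move=> W; have [|/ltnW] := leqP n m; first exact: W.
    move=> /(W _ _ Nn Nm); rewrite -[in X in X -> _](opprB (u m)).
    by rewrite symformNl// symformNr// opprK.
  rewrite -(subnKC mn); apply: le_lt_trans (uB _ _) _; exact: hN.
exists l => //.
have fixl : l - (G l + s%:C *: y) = 0.
  have LGy : L (G l + s%:C *: y) by apply: LD; [exact: LG|exact: LZ].
  apply: def; first exact: LB.
  apply/eqP; rewrite eq_le pos ?andbT; last exact: LB.
  apply/ler_addgt0Pl => e e0; rewrite addr0.
  have [N hN] := ul (e / 4) ltac:(by rewrite divr_gt0 ?ltr0n).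
  have h1 := hN N (leqnn _); have h2 := hN N.+1 (leqnSn _).
  set g := G l + _ in LGy *.
  have -> : l - g = - (u N.+1 - l) + (u N.+1 - g) by rewrite opprB addrC addrA subrK addrC.
  apply: le_trans (young 1 _ _ ltr01 _ _) _.
  - by rewrite opprB; apply: LB.
  - exact: LB.
  rewrite invr1 symformNl// symformNr// opprK.
  have -> : u N.+1 - g = G (u N - l).
    by rewrite GB /g /= opprD addrACA subrr addr0.
  have h3 := Gk _ (LB _ _ (Lu N) Ll).
  have h4 : k * B (u N - l) (u N - l) <= B (u N - l) (u N - l).
    by rewrite ler_piMl ?(ltW k1)//; apply/pos/LB.
  lra.
have /eqP : s%:C *: (T l - y) = 0.
  by rewrite -fixl /G opprD opprB addrA subrKC scalerBr.
rewrite scaler_eq0 -[0]/(0%:C) (inj_eq (@complexI _)) gt_eqF//= subr_eq0.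
by move/eqP.
Qed.

End Symmetric_forms.

(** * Geometry of a Krein space *)

Section Krein_geometry.
Variables (R : realType) (H : kreinSpace R).
Implicit Types (x y z : H).

(** The form [.,.] and the Hilbert inner product enter the estimates through their
    real parts reform and hform; hform x x is the squared norm of x. *)
Definition reform x y : R := complex.Re (kform x y).
Definition hform x y : R := complex.Re (krein_inner x y).

(** The fundamental symmetry, which exchanges reform and hform. *)
Definition krein_sym x : H := krein_projp x - krein_projm x.

Lemma reform_sym : symform reform.
Proof.
split=> [x y|x y z|t x z]; rewrite /reform.
- by rewrite kformC ReJ.
- by rewrite kformDl ReD.
- by rewrite kformZl ReZ.
Qed.

Lemma hform_sym : symform hform.
Proof.
split=> [x y|x y z|t x z]; rewrite /hform.
- by rewrite krein_innerC ReJ.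
- by rewrite krein_innerDl ReD.
- by rewrite krein_innerZl ReZ.
Qed.

Lemma kform_real x : kform x x = (reform x x)%:C.
Proof.
rewrite /reform; have := congr1 (@complex.Im _) (kformC x x); rewrite ImJ.
case: (kform x x) => a b /= h; have -> // : b = 0; lra.
Qed.

Lemma krein_inner_real x : krein_inner x x = (hform x x)%:C.
Proof.
rewrite /hform; have := krein_inner_ge0 x; rewrite lecE => /andP[/eqP] /=.
by case: (krein_inner x x) => a b /= ->.
Qed.

Lemma hform_ge0 x : 0 <= hform x x.
Proof. by have := krein_inner_ge0 x; rewrite krein_inner_real ler0c. Qed.

Lemma hform_eq0 x : hform x x = 0 -> x = 0.
Proof. by move=> h; apply: krein_inner_eq0; rewrite krein_inner_real h. Qed.

Lemma sqr_krein_norm x : `|x| ^+ 2 = (hform x x)%:C.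
Proof. by rewrite -krein_inner_real; exact: sqrtCK. Qed.

Lemma projp_id x : krein_pos x -> krein_projp x = x.
Proof.
have [_ [[L0 _] _ _] _ _ _] := krein_posnegP H => px.
by apply: (krein_proj_uniq px L0); rewrite addr0.
Qed.

Lemma projp_neg x : krein_neg x -> krein_projp x = 0.
Proof.
have [[[L0 _] _ _] _ _ _ _] := krein_posnegP H => nx.
by apply: (krein_proj_uniq L0 nx); rewrite add0r.
Qed.

Lemma krein_projpD x y : krein_projp (x + y) = krein_projp x + krein_projp y.
Proof. by have := krein_projpL 1 x y; rewrite !scale1r. Qed.

Lemma krein_projpN x : krein_projp (- x) = - krein_projp x.
Proof.
have [[[L0 _] _ _] _ _ _ _] := krein_posnegP H.
by have := krein_projpL (-1) x 0; rewrite (projp_id L0) !addr0 !scaleN1r.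
Qed.

Lemma krein_symL a x y :
  krein_sym (a *: x + y) = a *: krein_sym x + krein_sym y.
Proof.
by rewrite /krein_sym krein_projpL krein_projmL [in RHS]scalerDr scalerN opprD addrACA.
Qed.

Lemma kform_posneg x y : krein_pos x -> krein_neg y -> kform x y = 0.
Proof. by have [_ _ h _ _] := krein_posnegP H; exact: h. Qed.

Lemma krein_projDE x : x = krein_projp x + krein_projm x.
Proof. by rewrite /krein_projm addrC subrK. Qed.

Lemma hformE x y : hform x y =
  reform (krein_projp x) (krein_projp y) - reform (krein_projm x) (krein_projm y).
Proof. by rewrite /hform /krein_inner ReD ReN. Qed.

Lemma reform_posneg x y : krein_pos x -> krein_neg y -> reform x y = 0.
Proof. by move=> px ny; rewrite /reform kform_posneg. Qed.

Lemma hform_reform x y : hform x y = reform x (krein_sym y).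
Proof.
have [px nx] := krein_projpP x; have [py ny] := krein_projpP y.
rewrite hformE /krein_sym; set c := krein_projp y; set d := krein_projm y.
rewrite [in RHS](krein_projDE x); move: px nx py ny; rewrite -/c -/d.
move: (krein_projp x) (krein_projm x) c d => a b c d pa nb pc nd.
rewrite !(symformE reform_sym) (reform_posneg pa nd).
by rewrite (symformC reform_sym b c) (reform_posneg pc nb); ring.
Qed.

Lemma krein_symK x : krein_sym (krein_sym x) = x.
Proof.
have [px nx] := krein_projpP x.
have E : krein_projp (krein_sym x) = krein_projp x.
  by rewrite /krein_sym krein_projpD krein_projpN (projp_id px) (projp_neg nx) subr0.
rewrite {1}/krein_sym /krein_projm E /krein_sym [in RHS](krein_projDE x).
by move: (krein_projp x) (krein_projm x) => a b; rewrite addrAC subrr add0r opprK.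
Qed.

Lemma hform_krein_sym x : hform (krein_sym x) (krein_sym x) = hform x x.
Proof.
by rewrite hform_reform krein_symK (symformC reform_sym) -hform_reform.
Qed.

Lemma linear_subspaceT : linear_subspace [set: H].
Proof. by rewrite /linear_subspace /setT /=; split. Qed.

Lemma reform_CauchySchwarz x y : (reform x y) ^+ 2 <= hform x x * hform y y.
Proof.
have -> : reform x y = hform x (krein_sym y) by rewrite hform_reform krein_symK.
rewrite -(hform_krein_sym y).
by apply: (symform_CauchySchwarz hform_sym linear_subspaceT) => // z _; exact: hform_ge0.
Qed.

Lemma reform_le_hform x : `|reform x x| <= hform x x.
Proof.
rewrite -(ler_pXn2r (n := 2)) ?nnegrE ?hform_ge0//.
by rewrite -normrX ger0_norm ?sqr_ge0// (le_trans (reform_CauchySchwarz x x)) ?expr2.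
Qed.

Lemma hilbert_subspace_complete L (t : R) : t ^+ 2 = 1 ->
  hilbert_subspace L (fun x y => t%:C * kform x y) ->
  forall u : nat -> H, (forall n, L (u n)) ->
        (forall e : R, 0 < e -> exists N, forall m n, (N <= m)%N -> (N <= n)%N ->
           t * reform (u m - u n) (u m - u n) < e) ->
        exists2 l, L l &
          forall e : R, 0 < e -> exists N, forall n, (N <= n)%N ->
            t * reform (u n - l) (u n - l) < e.
Proof.
move=> t1 [_ _ cpl] u Lu cu.
have E x (e : R) : (t%:C * kform x x < e%:C) = (t * reform x x < e).
  by rewrite kform_real -rmorphM /= ltcR.
have [|l Ll hl] := cpl u Lu.
  move=> e; rewrite ltcE => /andP[/eqP /= e0 /cu[N hN]]; exists N => m n Nm Nn.
  have -> : e = (complex.Re e)%:C by move: e0; case: (e) => a b /= ->.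
  by rewrite E; exact: hN.
exists l => // e; rewrite -ltcR => /hl[N hN]; exists N => n Nn.
by rewrite -E; exact: hN.
Qed.

Lemma hform_hilbertian : hilbertian [set: H] hform.
Proof.
split=> //; [by move=> x _; exact: hform_ge0|by move=> x _; exact: hform_eq0|].
move=> u _ cu.
have [Hp Hm _ _ _] := krein_posnegP H.
have ep x : 0 <= reform (krein_projp x) (krein_projp x).
  have [px _] := krein_projpP x.
  by have := (kform_pos_ge0 px).1; rewrite kform_real ler0c.
have em x : reform (krein_projm x) (krein_projm x) <= 0.
  have [_ nx] := krein_projpP x; have := (kform_neg_ge0 nx).1.
  by rewrite kform_real -rmorphN /= ler0c oppr_ge0.
have PB x y : krein_projp x - krein_projp y = krein_projp (x - y).
  by rewrite krein_projpD krein_projpN.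
have MB x y : krein_projm x - krein_projm y = krein_projm (x - y).
  by rewrite /krein_projm krein_projpD krein_projpN !opprD addrACA.
have [||||lp plp hlp] := @hilbert_subspace_complete (@krein_pos R H) 1 _ _
    (fun n => krein_projp (u n)).
- by rewrite expr1n.
- by under eq_fun do under eq_fun do rewrite mul1r.
- by move=> n; have [] := krein_projpP (u n).
- move=> e /cu[N hN]; exists N => m n Nm Nn; rewrite mul1r PB.
  by have := hN m n Nm Nn; rewrite hformE; have := em (u m - u n); lra.
have [||||lm nlm hlm] := @hilbert_subspace_complete (@krein_neg R H) (-1) _ _
    (fun n => krein_projm (u n)).
- by rewrite sqrrN expr1n.
- by under eq_fun do under eq_fun do rewrite rmorphN1 mulN1r.
- by move=> n; have [] := krein_projpP (u n).
- move=> e /cu[N hN]; exists N => m n Nm Nn; rewrite mulN1r MB.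
  by have := hN m n Nm Nn; rewrite hformE; have := ep (u m - u n); lra.
exists (lp + lm) => // e e0.
have e20 : 0 < e / 2 by rewrite divr_gt0.
have [N1 h1] := hlp _ e20; have [N2 h2] := hlm _ e20.
exists (maxn N1 N2) => n; rewrite geq_max => /andP[/h1 {}h1 /h2 {}h2].
have Ep : krein_projp (lp + lm) = lp by apply: (krein_proj_uniq plp nlm).
have Em : krein_projm (lp + lm) = lm by rewrite /krein_projm Ep addrC addrA addNr add0r.
rewrite hformE -PB -MB Ep Em; lra.
Qed.

Lemma hform_sqrD (x y : H) :
  hform (x + y) (x + y) <= 2 * hform x x + 2 * hform y y.
Proof.
have := hform_ge0 (x - y).
rewrite (symform_sqrB hform_sym) (symform_sqrD hform_sym); lra.
Qed.

Lemma hformN (x : H) : hform (- x) (- x) = hform x x.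
Proof.
by rewrite (symformNl hform_sym) (symformNr hform_sym) opprK.
Qed.

Lemma hformB (x y : H) : hform (x - y) (x - y) = hform (y - x) (y - x).
Proof. by rewrite -hformN opprB. Qed.

Lemma hformZ (a : R[i]) (x : H) : hform (a *: x) (a *: x) = sqmod a * hform x x.
Proof.
rewrite /hform krein_innerZl krein_innerZr krein_inner_real mulrA -normCK.
by rewrite normC_sqmod -rmorphM /=.
Qed.

Lemma norm_lt_hform (x : H) (e : R[i]) : 0 < e ->
  (`|x| < e) = (hform x x < complex.Re e ^+ 2).
Proof.
move=> e0; have -> : e = (complex.Re e)%:C.
  by move: e0; rewrite ltcE => /andP[/eqP]; case: e => a b /= ->.
rewrite -(ltr_pXn2r (n := 2)) ?nnegrE ?normr_ge0 ?ler0c//; last first.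
  by move: e0; rewrite ltcE => /andP[_ /ltW].
by rewrite sqr_krein_norm -rmorphXn ltcR.
Qed.

Lemma reform_nondegenerate x z : (forall y, reform x y = reform z y) -> x = z.
Proof.
move=> h; apply/eqP; rewrite -subr_eq0; apply/eqP/hform_eq0.
rewrite hform_reform (symformDl reform_sym) (symformNl reform_sym).
by rewrite h subrr.
Qed.

Lemma reformZ (t : R[i]) x : reform (t *: x) (t *: x) = sqmod t * reform x x.
Proof.
rewrite /reform kformZl (kformC x) kformZl rmorphM /= -kformC mulrA -normCK.
by rewrite normC_sqmod ReZ.
Qed.

Definition imform x y : R := complex.Im (kform x y).

Lemma imformDl x y z : imform (x + y) z = imform x z + imform y z.
Proof. by rewrite /imform kformDl; case: (kform x z); case: (kform y z). Qed.

Lemma reformZl (t : R[i]) x y : reform (t *: x) y =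
  complex.Re t * reform x y - complex.Im t * imform x y.
Proof. by rewrite /reform /imform kformZl; case: t; case: (kform x y). Qed.

Lemma imformZl (t : R[i]) x y : imform (t *: x) y =
  complex.Re t * imform x y + complex.Im t * reform x y.
Proof. by rewrite /reform /imform kformZl; case: t; case: (kform x y). Qed.

Lemma imformC x y : imform x y = - imform y x.
Proof. by rewrite /imform kformC ImJ. Qed.

Lemma imformNl x y : imform (- x) y = - imform x y.
Proof. by rewrite -scaleN1r imformZl /= oppr0 mul0r addr0 mulN1r. Qed.

Lemma imform_reform x y : imform x y = reform ((0 -i* 1) *: x) y.
Proof. by rewrite reformZl /= mul0r add0r mulN1r opprK. Qed.

Lemma imform_CauchySchwarz x y : (imform x y) ^+ 2 <= hform x x * hform y y.
Proof.
rewrite imform_reform; apply: le_trans (reform_CauchySchwarz _ _) _.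
by rewrite hformZ sqmodE /= expr0n add0r sqrrN expr1n mul1r.
Qed.

Lemma kform_eq0 x y : reform x y = 0 -> imform x y = 0 -> kform x y = 0.
Proof. by rewrite /reform /imform; case: (kform x y) => a b /= -> ->. Qed.

(** The Hilbert adjoint of T is J T' J. If T' is bounded below then T J T' J is
    coercive, hence onto by the Lax-Milgram lemma. *)
Lemma surjective_of_bounded_below (T T' : H -> H) (C c : R) :
  (forall a x y, T (a *: x + y) = a *: T x + T y) ->
  (forall a x y, T' (a *: x + y) = a *: T' x + T' y) ->
  (forall x y, reform (T x) y = reform x (T' y)) ->
  (forall x, hform (T x) (T x) <= C * hform x x) ->
  (forall x, hform (T' x) (T' x) <= C * hform x x) ->
  0 < c -> (forall x, c * hform x x <= hform (T' x) (T' x)) ->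
  forall y, exists x, T x = y.
Proof.
move=> TL T'L adj bT bT' c0 low y.
pose U x := T (krein_sym (T' (krein_sym x))).
suff [x _ <-] : exists2 x, [set: H] x & U x = y by exists (krein_sym (T' (krein_sym x))).
apply: (@Lax_Milgram _ _ [set: H] hform U (C ^+ 2) c hform_sym hform_hilbertian) => //.
- by move=> a x z; rewrite /U krein_symL T'L krein_symL TL.
- move=> x _; rewrite /U [hform (T _) _]hform_reform adj (symformC reform_sym).
  by rewrite -hform_reform -(hform_krein_sym x).
- move=> x _; have [C0|C0] := leP 0 C; last first.
    have : forall z, hform z z = 0.
      move=> z; apply/eqP; rewrite eq_le hform_ge0 andbT -(nmulr_rge0 _ C0).
      by rewrite (le_trans (hform_ge0 _) (bT z)).
    by move=> h; rewrite !h mulr0.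
  apply: le_trans (bT _) _; rewrite expr2 -mulrA ler_wpM2l// hform_krein_sym.
  by apply: le_trans (bT' _) _; rewrite hform_krein_sym.
Qed.

End Krein_geometry.

(** * Sums of nonnegative reals over finite subsets *)

Section Finite_sums.
Variables (R : realType) (I : choiceType).
Implicit Types (a b : I -> R) (J : {fset I}).

Lemma fset_le_esum a J :
  ((\sum_(i <- J) a i)%:E <= \esum_(i in [set: I]) (a i)%:E)%E.
Proof.
rewrite -sumEFin; apply: ereal_sup_ubound.
exists [set` J]; first by split => //; exact: finite_fset.
exact/esym/(fsbig_seq _ _ (fset_uniq J)).
Qed.

Lemma esum_le_fset a (M : R) : (forall i, 0 <= a i) ->
  (\esum_(i in [set: I]) (a i)%:E <= M%:E)%E <->
  forall J, \sum_(i <- J) a i <= M.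
Proof.
move=> a0; split=> [h J|h].
  by rewrite -lee_fin; apply: le_trans h; exact: fset_le_esum.
apply: ge_ereal_sup => _ [A [finA _] <-].
by rewrite fsbig_finite//= sumEFin lee_fin.
Qed.

Lemma fset_sumD (V : nmodType) (u : I -> V) J0 J : (J0 `<=` J)%fset ->
  \sum_(i <- J) u i = \sum_(i <- J0) u i + \sum_(i <- (J `\` J0)%fset) u i.
Proof.
move=> JJ'; rewrite (big_fsetID _ (fun i => i \in J0)); congr (_ + _);
  apply: eq_fbigl => i; rewrite !inE /= ?andbT; last by rewrite andbC.
by apply: andb_idl => iJ0; exact: (fsubsetP JJ').
Qed.

Lemma fset_sum_sub a J J' : (forall i, 0 <= a i) -> (J `<=` J')%fset ->
  \sum_(i <- J) a i <= \sum_(i <- J') a i.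
Proof. by move=> a0 JJ'; rewrite [leRHS](fset_sumD _ JJ') lerDl sumr_ge0. Qed.

Definition fnet_lim a (s : R) := forall e : R, 0 < e -> exists J0 : {fset I},
  forall J, (J0 `<=` J)%fset -> `|\sum_(i <- J) a i - s| < e.

Lemma fnet_lim_unique a s t : fnet_lim a s -> fnet_lim a t -> s = t.
Proof.
move=> hs ht; apply/eqP; rewrite -subr_eq0 -normr_eq0 eq_le normr_ge0 andbT.
apply/ler_addgt0Pl => e e0; rewrite addr0.
have e20 : 0 < e / 2 by rewrite divr_gt0.
have [J1 h1] := hs _ e20; have [J2 h2] := ht _ e20.
have {}h1 := h1 _ (fsubsetUl J1 J2); have {}h2 := h2 _ (fsubsetUr J1 J2).
move: h1 h2; set u := \sum_(i <- _) _ => h1 h2.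
rewrite -[s - t](subrKA u) addrC (le_trans (ler_normD _ _))//.
by rewrite (distrC s u); lra.
Qed.

Lemma fnet_lim_esum a s : (forall i, 0 <= a i) -> fnet_lim a s ->
  (\esum_(i in [set: I]) (a i)%:E = s%:E)%E.
Proof.
move=> a0 hs; apply/eqP; rewrite eq_le; apply/andP; split.
  apply/(esum_le_fset _ a0) => J; apply/ler_addgt0Pl => e /hs[J0 h0].
  have := h0 _ (fsubsetUl J0 J); have := fset_sum_sub a0 (fsubsetUr J0 J).
  rewrite ltr_norml => h1 /andP[_ h2]; lra.
apply/lee_addgt0Pr => e /hs[J0 /(_ _ (fsubset_refl _))].
rewrite ltr_norml => /andP[h1 _].
apply: (@le_trans _ _ ((\sum_(i <- J0) a i)%:E + e%:E)%E).
  by rewrite -EFinD lee_fin; lra.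
by rewrite leeD2r// fset_le_esum.
Qed.

(** The supremum of the finite sums is nearly attained on some J0, which leaves
    little for the indices outside J0. *)
Lemma esum_tail a (M : R) : (forall i, 0 <= a i) ->
  (forall J, \sum_(i <- J) a i <= M) ->
  forall e : R, 0 < e -> exists J0 : {fset I}, forall J, (J0 `<=` J)%fset ->
    \sum_(i <- (J `\` J0)%fset) a i < e.
Proof.
move=> a0 hM e e0; pose E := [set \sum_(i <- J) a i | J in [set: {fset I}]].
have hE : has_sup E.
  split; first by exists (\sum_(i <- (fset0 : {fset I})) a i), fset0.
  by exists M => _ [J _ <-].
have [_ [J0 _ <-] h0] := sup_adherent e0 hE.
exists J0 => J JJ0.
have : \sum_(i <- J) a i <= sup E by apply: sup_upper_bound => //; exists J.
rewrite (fset_sumD _ JJ0); lra.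
Qed.

End Finite_sums.

(** * Unconditional sums of vectors *)

Section Unconditional_sums.
Variables (R : realType) (H : kreinSpace R) (I : choiceType).
Implicit Types (u v : I -> H) (l m : H) (J : {fset I}).

(** Convergence of the net of finite partial sums, measured by the squared norm so
    that only real numbers occur. *)
Definition fnet_cvg u l := forall e : R, 0 < e -> exists J0 : {fset I},
  forall J, (J0 `<=` J)%fset ->
    hform (\sum_(i <- J) u i - l) (\sum_(i <- J) u i - l) < e.

Lemma fnet_cvg_sum u l : fnet_cvg u l -> summability.sum u = l.
Proof.
move=> ul; have FF := @summability.totally_filter I.
apply: cvg_lim; first exact: norm_hausdorff.
apply/cvgrPdist_lt => e e0.
have re0 : 0 < complex.Re e ^+ 2.
  by rewrite exprn_gt0//; move: e0; rewrite ltcE => /andP[].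
have [J0 h0] := ul _ re0.
exists J0 => // J /= /h0; rewrite distrC norm_lt_hform//.
by rewrite /summability.partial_sum big_seq_fsetE.
Qed.

Lemma fnet_cvgL (a : R[i]) u v l m : fnet_cvg u l -> fnet_cvg v m ->
  fnet_cvg (fun i => a *: u i + v i) (a *: l + m).
Proof.
move=> ul vm e e0.
have e1 : 0 < e / (4 * (sqmod a + 1)).
  by rewrite divr_gt0// mulr_gt0// ltr_wpDl ?sqmod_ge0.
have [J1 h1] := ul _ e1.
have [J2 h2] := vm (e / 4) ltac:(by rewrite divr_gt0).
exists (J1 `|` J2)%fset => J; rewrite fsubUset => /andP[/h1 {}h1 /h2 {}h2].
rewrite big_split -scaler_sumr /= opprD addrACA -scalerBr.
apply: le_lt_trans (hform_sqrD _ _) _; rewrite hformZ.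
have h3 : sqmod a * (e / (4 * (sqmod a + 1))) <= e / 4.
  have -> : e / 4 = (sqmod a + 1) * (e / (4 * (sqmod a + 1))).
    by field; rewrite gt_eqF// ltr_wpDl ?sqmod_ge0.
  by rewrite ler_wpM2r ?(ltW e1)// lerDl.
have := ler_wpM2l (sqmod_ge0 a) (ltW h1); lra.
Qed.

Lemma fnet_cvg_reform u l (y : H) : fnet_cvg u l ->
  fnet_lim (fun i => reform (u i) y) (reform l y).
Proof.
move=> ul e e0.
have y1 : 0 < hform y y + 1 by rewrite ltr_wpDl ?hform_ge0.
have [J0 h0] := ul (e ^+ 2 / (hform y y + 1)) ltac:(by rewrite divr_gt0// exprn_gt0).
exists J0 => J /h0 {}h0.
have E (v : I -> H) : \sum_(i <- J) reform (v i) y = reform (\sum_(i <- J) v i) y.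
  elim/big_rec2: _ => [|i s x _ ->]; first by rewrite (symform0l (@reform_sym R H)).
  by rewrite (symformDl (@reform_sym R H)).
rewrite E -(symformNl (@reform_sym R H)) -(symformDl (@reform_sym R H)).
rewrite -(ltr_pXn2r (n := 2)) ?nnegrE ?(ltW e0)// -normrX ger0_norm ?sqr_ge0//.
apply: le_lt_trans (reform_CauchySchwarz _ _) _.
move: h0; rewrite ltr_pdivlMr// => h0.
by apply: le_lt_trans h0; rewrite ler_wpM2l ?hform_ge0// lerDl.
Qed.

Lemma fnet_cvg_unique u l m : fnet_cvg u l -> fnet_cvg u m -> l = m.
Proof.
move=> ul um; apply: reform_nondegenerate => y.
exact: fnet_lim_unique (fnet_cvg_reform y ul) (fnet_cvg_reform y um).
Qed.

Lemma fnet_cvg_hform_le u l (B : R) : fnet_cvg u l ->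
  (forall J, hform (\sum_(i <- J) u i) (\sum_(i <- J) u i) <= B) ->
  hform l l <= 2 * B.
Proof.
move=> ul hB; apply/ler_addgt0Pl => e e0.
have [J0 h0] := ul (e / 2) ltac:(by rewrite divr_gt0).
have {}h0 := h0 _ (fsubset_refl _); have h1 := hB J0.
move: h0 h1; set s := \sum_(i <- _) _ => h0 h1.
have -> : l = (l - s) + s by rewrite subrK.
apply: le_trans (hform_sqrD _ _) _; rewrite hformB; lra.
Qed.

(** Along finite sets J(n) outside of which all sums are below 1 / (n + 1) the
    partial sums are Cauchy; the whole net inherits the limit of this sequence. *)
Lemma fnet_cvg_cauchy u :
  (forall e : R, 0 < e -> exists J0 : {fset I}, forall J, (J0 `<=` J)%fset ->
     hform (\sum_(i <- (J `\` J0)%fset) u i) (\sum_(i <- (J `\` J0)%fset) u i) < e) ->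
  exists l, fnet_cvg u l.
Proof.
move=> cu.
have eps n : 0 < (n.+1%:R : R)^-1 by rewrite invr_gt0 ltr0n.
pose Jn n := projT1 (cid (cu _ (eps n))).
have hJ n J : (Jn n `<=` J)%fset ->
    hform (\sum_(i <- J) u i - \sum_(i <- Jn n) u i)
      (\sum_(i <- J) u i - \sum_(i <- Jn n) u i) < (n.+1%:R)^-1.
  move=> JJ; have := projT2 (cid (cu _ (eps n))) J JJ.
  by rewrite (fset_sumD u JJ) addrAC subrr add0r.
have small (e : R) : 0 < e -> exists N, forall n, (N <= n)%N -> (n.+1%:R)^-1 < e.
  move=> e0; exists (Num.truncn e^-1) => n Nn.
  rewrite -(invrK e) ltf_pV2 ?posrE ?invr_gt0//.
  apply: lt_le_trans (truncnS_gt _) _.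
  by rewrite ler_nat ltnS.
have [_ _ _ cpl] := hform_hilbertian H.
have [|l _ hl] := cpl (fun n => \sum_(i <- Jn n) u i) (fun _ => Logic.I).
  move=> e e0; have [N hN] := small (e / 4) ltac:(by rewrite divr_gt0).
  exists N => m n /hN hm /hN hn.
  have := hJ m _ (fsubsetUl (Jn m) (Jn n)); have := hJ n _ (fsubsetUr (Jn m) (Jn n)).
  set s := \sum_(i <- (_ `|` _)%fset) _.
  set a := \sum_(i <- Jn n) _; set b := \sum_(i <- Jn m) _ => h1 h2.
  have -> : b - a = (s - a) + - (s - b) by rewrite opprB [RHS]addrC subrKA.
  apply: le_lt_trans (hform_sqrD _ _) _; rewrite hformN.
  have := lt_trans h1 hn; have := lt_trans h2 hm; lra.
exists l => e e0.
have e40 : 0 < e / 4 by rewrite divr_gt0.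
have [N1 h1] := small _ e40; have [N2 h2] := hl _ e40.
pose n := maxn N1 N2; exists (Jn n) => J /hJ h3.
have {}h1 := h1 n (leq_maxl _ _); have {}h2 := h2 n (leq_maxr _ _).
have -> : \sum_(i <- J) u i - l = (\sum_(i <- J) u i - \sum_(i <- Jn n) u i) +
    (\sum_(i <- Jn n) u i - l) by rewrite addrA subrK.
apply: le_lt_trans (hform_sqrD _ _) _; have := lt_trans h3 h1; lra.
Qed.

End Unconditional_sums.

(** * Synthesis operators and the two parts of the frame operator *)

Section Frame_parts.
Variables (R : realType) (H : kreinSpace R) (I : choiceType).
Variables (F : I -> H) (hF : bessel F).
Implicit Types (A : set I) (f g : H) (J : {fset I}) (x : I -> R[i]).

Definition frame_part A f : H := usum A (fun i => kform f (F i) *: F i).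

(** Turns the Bessel condition, which is stated for the Hilbert inner product, into
    one for the indefinite form. *)
Lemma kform_krein_inner f g : kform f g = krein_inner (krein_sym f) g.
Proof.
have [pf nf] := krein_projpP f; have [pg ng] := krein_projpP g.
have E : krein_projp (krein_sym f) = krein_projp f.
  by rewrite /krein_sym krein_projpD krein_projpN (projp_id pf) (projp_neg nf) subr0.
have E' : krein_projm (krein_sym f) = - krein_projm f.
  rewrite {1}/krein_projm E /krein_sym.
  by move: (krein_projp f) (krein_projm f) => a b; rewrite addrAC subrr add0r.
rewrite /krein_inner E E' -[- krein_projm f]scaleN1r kformZl mulN1r opprK.
have Dr (z y y' : H) : kform z (y + y') = kform z y + kform z y'.
  by rewrite kformC kformDl rmorphD /= -!kformC.
rewrite [in LHS](krein_projDE f) [in LHS](krein_projDE g).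
move: pf nf pg ng.
move: (krein_projp f) (krein_projm f) (krein_projp g) (krein_projm g) => a b c d.
move=> pa nb pc nd; rewrite kformDl !Dr (kform_posneg pa nd) (kformC b c).
by rewrite (kform_posneg pc nb) rmorph0 addr0 add0r.
Qed.

Lemma bessel_fset : exists2 b : R, 0 < b & forall f J,
  \sum_(i <- J) sqmod (krein_inner f (F i)) <= b * hform f f.
Proof.
have [b hb] := hF; exists (Num.max b 1); first by rewrite lt_max ltr01 orbT.
move=> f J; have := hb f.
rewrite sqr_krein_norm /= => /esum_le_fset h.
apply: le_trans (h _ J) _; first by move=> i; exact: sqmod_ge0.
by rewrite ler_wpM2r ?hform_ge0// le_max lexx.
Qed.

Lemma hform_suml (u : I -> H) g J :
  hform (\sum_(i <- J) u i) g = \sum_(i <- J) hform (u i) g.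
Proof.
elim/big_rec2: _ => [|i s t _ <-]; first by rewrite (symform0l (@hform_sym R H)).
by rewrite (symformDl (@hform_sym R H)).
Qed.

(** The squared norm of the sum v pairs x with the analysis coefficients of v. The
    Bessel bound and the weighted arithmetic-geometric mean inequality then leave
    half of this squared norm on the left-hand side. *)
Lemma synthesis_fset : exists2 b : R, 0 < b & forall x J,
  hform (\sum_(i <- J) x i *: F i) (\sum_(i <- J) x i *: F i) <=
  b * \sum_(i <- J) sqmod (x i).
Proof.
have [b b0 hb] := bessel_fset; exists (b); first by [].
move=> x J; set v := \sum_(i <- J) _.
have : hform v v <= b / 2 * (\sum_(i <- J) sqmod (x i)) + (2 * b)^-1 * (b * hform v v).
  rewrite {1}/v hform_suml mulr_sumr.
  apply: (@le_trans _ _ (\sum_(i <- J) (b / 2 * sqmod (x i) +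
      (2 * b)^-1 * sqmod (krein_inner v (F i))))).
    apply: ler_sum => i _; rewrite /hform krein_innerZl (krein_innerC (F i)).
    exact: Re_mulJ_le.
  rewrite big_split /= -!mulr_sumr lerD2l.
  apply: ler_wpM2l; last by rewrite -hform_suml; exact: hb.
  by rewrite invr_ge0 mulr_ge0 ?(ltW b0).
have -> : (2 * b)^-1 * (b * hform v v) = hform v v / 2 by field; rewrite gt_eqF.
lra.
Qed.

Lemma ell2_bound x : ell2 x -> exists M : R, forall J, \sum_(i <- J) sqmod (x i) <= M.
Proof.
rewrite /ell2 /= => fin.
have : (\esum_(i in [set: I]) (sqmod (x i))%:E)%E \is a fin_num.
  by rewrite ge0_fin_numE// esum_ge0// => i _; rewrite lee_fin sqmod_ge0.
move=> /fineK E; exists (fine (\esum_(i in [set: I]) (sqmod (x i))%:E)%E).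
by apply/esum_le_fset; [move=> i; exact: sqmod_ge0|rewrite E].
Qed.

Lemma cut_term A x i : (if i \in A then x i *: F i else 0) =
  (if i \in A then x i else 0) *: F i.
Proof. by case: ifP => // _; rewrite scale0r. Qed.

Lemma sqmod_cut_le A x i : sqmod (if i \in A then x i else 0) <= sqmod (x i).
Proof.
case: ifP => // _; apply: le_trans (sqmod_ge0 _).
by rewrite sqmodE /= expr0n addr0.
Qed.

Lemma synthesis_cvg A x : ell2 x ->
  fnet_cvg (fun i => if i \in A then x i *: F i else 0) (synthesis F A x).
Proof.
move=> /ell2_bound[M hM].
suff [l hl] : exists l : H, fnet_cvg (fun i => if i \in A then x i *: F i else 0) l.
  by rewrite /synthesis /usum (fnet_cvg_sum hl).
have [b b0 hb] := synthesis_fset.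
apply: fnet_cvg_cauchy => e e0.
have [J0 h0] := esum_tail (fun i => sqmod_ge0 (x i)) hM (divr_gt0 e0 b0).
exists J0 => J /h0 {}h0; under eq_bigr do rewrite cut_term.
apply: le_lt_trans (hb _ _) _; rewrite mulrC -ltr_pdivlMr//.
by apply: le_lt_trans h0; apply: ler_sum => i _; exact: sqmod_cut_le.
Qed.

Lemma analysis_fset : exists2 b : R, 0 < b & forall f J,
  \sum_(i <- J) sqmod (kform f (F i)) <= b * hform f f.
Proof.
have [b b0 hb] := bessel_fset; exists b => // f J.
under eq_bigr do rewrite kform_krein_inner.
by rewrite -(hform_krein_sym f).
Qed.

Lemma analysis_ell2 f : ell2 (fun i => kform f (F i)).
Proof.
have [b b0 hb] := analysis_fset.
rewrite /ell2 /=; apply: le_lt_trans (ltry (b * hform f f)).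
by apply/esum_le_fset => [i|J]; [exact: sqmod_ge0|exact: hb].
Qed.

Lemma frame_part_synthesis A f :
  frame_part A f = synthesis F A (fun i => kform f (F i)).
Proof. by []. Qed.

Lemma frame_part_range A f : (synthesis F A @` @ell2 R I) (frame_part A f).
Proof. by exists (fun i => kform f (F i)) => //; exact: analysis_ell2. Qed.

Lemma frame_part_cvg A f :
  fnet_cvg (fun i => if i \in A then kform f (F i) *: F i else 0) (frame_part A f).
Proof. by rewrite frame_part_synthesis; exact/synthesis_cvg/analysis_ell2. Qed.

Lemma frame_partL A a f g :
  frame_part A (a *: f + g) = a *: frame_part A f + frame_part A g.
Proof.
apply: fnet_cvg_unique (frame_part_cvg A _) _.
have := fnet_cvgL a (frame_part_cvg A f) (frame_part_cvg A g).
congr fnet_cvg; apply/funext => i; case: ifP => _; last by rewrite scaler0 addr0.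
by rewrite kformDl kformZl scalerDl scalerA.
Qed.

Lemma reform_term A f g i : reform (if i \in A then kform f (F i) *: F i else 0) g =
  if i \in A then complex.Re (kform f (F i) * Num.conj (kform g (F i))) else 0.
Proof.
case: ifP => _; last by rewrite (symform0l (@reform_sym R H)).
by rewrite /reform kformZl (kformC (F i)).
Qed.

(** Both sides are limits of the same net, because each term of the sum is Hermitian
    in f and g. *)
Lemma frame_part_sym A f g :
  reform (frame_part A f) g = reform f (frame_part A g).
Proof.
rewrite [RHS](symformC (@reform_sym R H)).
apply: fnet_lim_unique (fnet_cvg_reform _ (frame_part_cvg A f)) _.
have := fnet_cvg_reform f (frame_part_cvg A g).
congr fnet_lim; apply/funext => i; rewrite !reform_term; case: ifP => // _.
by case: (kform f _) => a b; case: (kform g _) => c d /=; ring.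
Qed.

Lemma esum_frame_part A f :
  (\esum_(i in A) (sqmod (kform f (F i)))%:E = (reform (frame_part A f) f)%:E)%E.
Proof.
rewrite esum_mkcond; set a := fun i : I => if i \in A then sqmod (kform f (F i)) else 0.
have -> : (\esum_(i in [set: I]) (if i \in A then (sqmod (kform f (F i)))%:E else 0) =
    \esum_(i in [set: I]) (a i)%:E)%E.
  by apply: eq_esum => i _; rewrite /a; case: ifP.
apply: fnet_lim_esum.
  by move=> i; rewrite /a; case: ifP => // _; exact: sqmod_ge0.
have := fnet_cvg_reform f (frame_part_cvg A f).
congr fnet_lim; apply/funext => i; rewrite reform_term /a; case: ifP => // _.
by rewrite sqmodE; case: (kform f _) => c d /=; ring.
Qed.

Lemma frame_part_ge0 A f : 0 <= reform (frame_part A f) f.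
Proof.
rewrite -lee_fin -esum_frame_part esum_ge0// => i _.
by rewrite lee_fin sqmod_ge0.
Qed.

Lemma frame_part_bounded : exists2 C : R, 0 < C & forall A f,
  hform (frame_part A f) (frame_part A f) <= C * hform f f.
Proof.
have [b b0 hb] := analysis_fset; have [c c0 hc] := synthesis_fset.
exists (2 * (c * b)) => [|A f]; first by rewrite !mulr_gt0.
rewrite -mulrA; apply: fnet_cvg_hform_le (frame_part_cvg A f) _ => J.
under eq_bigr do rewrite (cut_term A (fun i => kform f (F i))).
apply: le_trans (hc _ _) _; rewrite -mulrA ler_wpM2l ?(ltW c0)//.
apply: le_trans (hb f J); apply: ler_sum => i _.
exact: (sqmod_cut_le A (fun i => kform f (F i))).
Qed.

Lemma synthesis_delta A i : A i -> (synthesis F A @` @ell2 R I) (F i).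
Proof.
move=> Ai; pose x j : R[i] := if j == i then 1 else 0.
have x2 : ell2 x.
  rewrite /ell2 /=; apply: le_lt_trans (ltry 1).
  apply/esum_le_fset => [j|J]; first exact: sqmod_ge0.
  apply: (@le_trans _ _ (\sum_(j <- (i |` J)%fset) sqmod (x j))).
    by apply: fset_sum_sub; [move=> j; exact: sqmod_ge0|exact: fsubsetU1].
  rewrite (big_fsetD1 i) ?fset1U1//= big_seq big1 => [|j].
    by rewrite addr0 /x eqxx sqmodE /= expr1n expr0n addr0.
  rewrite !inE => /andP[/negbTE ji _]; by rewrite /x ji sqmodE /= !expr0n addr0.
exists x => //; apply: fnet_cvg_unique (synthesis_cvg A x2) _ => e e0.
exists [fset i]%fset => J; rewrite fsub1set => iJ.
rewrite (big_fsetD1 i)//= big_seq big1 => [|j].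
  rewrite mem_set// addr0 /x eqxx scale1r subrr.
  by rewrite (symform0l (@hform_sym R H)).
by rewrite !inE => /andP[/negbTE ji _]; rewrite /x ji scale0r if_same.
Qed.

(** Closure in the norm topology, without the complex radii of its balls. *)
Definition adherent (X : set H) (l : H) := forall e : R, 0 < e ->
  exists2 m, X m & hform (l - m) (l - m) < e.

Lemma adherent_closure (X : set H) l : adherent X l -> closure X l.
Proof.
move=> adh B /nbhs_ballP[e /= e0 eB].
have re0 : 0 < complex.Re e ^+ 2.
  by rewrite exprn_gt0//; move: e0; rewrite ltcE => /andP[].
have [m Xm lm] := adh _ re0; exists m; split => //; apply: eB.
by rewrite -ball_normE /= norm_lt_hform.
Qed.

Lemma linear_span_cons (X : set H) a v w :
  X v -> linear_span X w -> linear_span X (a *: v + w).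
Proof.
move=> Xv [n [c [u [Xu ->]]]].
exists n.+1, (fun k => oapp c a (unlift ord0 k)), (fun k => oapp u v (unlift ord0 k)).
split; first by move=> k; case: (unlift ord0 k).
rewrite big_ord_recl /= unlift_none /=; congr (_ + _).
by apply: eq_bigr => k _; rewrite liftK.
Qed.

Lemma synthesis_adherent A x : ell2 x ->
  adherent (linear_span (F @` A)) (synthesis F A x).
Proof.
move=> /(synthesis_cvg A) cv e /cv[J0 /(_ _ (fsubset_refl _)) h0].
eexists; last by rewrite hformB; exact: h0.
elim/big_rec: _ => [|i s _ ss].
  by exists 0%N, (fun _ => 0), (fun _ => 0); split=> [[]//|]; rewrite big_ord0.
case: ifP => [/set_mem Ai|_]; last by rewrite add0r.
by apply: linear_span_cons => //; exists i.
Qed.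

End Frame_parts.

(** * A maximal uniformly definite range *)

Section One_side.
Variables (R : realType) (H : kreinSpace R).
Implicit Types (x y : H) (L : set H).

Definition uniformly_definite (s : R) L := linear_subspace L /\
  exists2 a : R, 0 < a & forall x, L x -> a * hform x x <= s * reform x x.

Lemma uniformly_positiveE L : uniformly_positive L <-> uniformly_definite 1 L.
Proof.
split=> -[LL [a a0 ha]]; split=> //; exists a => // x /ha.
  by rewrite sqr_krein_norm kform_real -rmorphM /= lecR mul1r.
by rewrite sqr_krein_norm kform_real -rmorphM /= lecR mul1r.
Qed.

Lemma uniformly_negativeE L : uniformly_negative L <-> uniformly_definite (-1) L.
Proof.
split=> -[LL [a a0 ha]]; split=> //; exists a => // x /ha.
  by rewrite sqr_krein_norm kform_real -rmorphM -rmorphN /= lecR mulN1r.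
by rewrite sqr_krein_norm kform_real -rmorphM -rmorphN /= lecR mulN1r.
Qed.

Lemma eq_maximal_subspace (P P' : set H -> Prop) L :
  (forall L', P L' <-> P' L') -> maximal_subspace P L -> maximal_subspace P' L.
Proof. by move=> PP' [/PP' PL h]; split=> // L' /PP'; exact: h. Qed.

(** The operator data carried by the frame vectors of one sign s = 1 or -1: the
    range M of their synthesis operator and the part U of the frame operator. *)
Record frame_side (s : R) (M : set H) (U : H -> H) : Prop := FrameSide {
  side_sign : s ^+ 2 = 1;
  side_max : maximal_subspace (uniformly_definite s) M;
  side_linear : forall (a : R[i]) x y, U (a *: x + y) = a *: U x + U y;
  side_sym : forall x y, reform (U x) y = reform x (U y);
  side_bounded : exists2 C : R, 0 < C & forall x, hform (U x) (U x) <= C * hform x x;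
  side_ge0 : forall x, 0 <= reform (U x) x;
  side_range : forall x, M (U x);
  side_coercive : exists2 c : R, 0 < c & forall x, M x ->
    c * (s * reform x x) <= reform (U x) x }.

Variables (s : R) (M : set H) (U : H -> H).
Hypothesis hM : frame_side s M U.

Let B x y := s * reform x y.
Let rS := @reform_sym R H.
Let hS := @hform_sym R H.

Lemma side_form_sym : symform B.
Proof.
split=> [x y|x y z|t x z]; rewrite /B.
- by rewrite (symformC rS).
- by rewrite (symformDl rS) mulrDr.
- by rewrite (symformZl rS) mulrCA.
Qed.
Let bS := side_form_sym.

Lemma side_normr : `|s| = 1.
Proof.
apply/eqP; rewrite -(@eqrXn2 _ 2)//.
by rewrite -normrX (side_sign hM) normr1 expr1n.
Qed.

Lemma side_sign_neq0 : s != 0.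
Proof.
have := side_sign hM; apply: contra_eq_neq => ->.
by rewrite expr0n /= eq_sym oner_eq0.
Qed.

Lemma side_subspace : linear_subspace M.
Proof. by have [[]] := side_max hM. Qed.

Lemma subspaceB L x y : linear_subspace L -> L x -> L y -> L (x - y).
Proof. by move=> [_ LL] Lx Ly; rewrite addrC -scaleN1r; exact: LL. Qed.

Lemma subspaceZ L (a : R[i]) x : linear_subspace L -> L x -> L (a *: x).
Proof. by move=> [L0 LL] Lx; rewrite -[_ *: _]addr0; exact: LL. Qed.

Lemma subspaceN L x : linear_subspace L -> L x -> L (- x).
Proof. by move=> LL Lx; rewrite -scaleN1r; exact: subspaceZ. Qed.

Lemma sideB x y : U (x - y) = U x - U y.
Proof. by rewrite addrC -scaleN1r (side_linear hM) scaleN1r addrC. Qed.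

Lemma sideZ (a : R[i]) x : U (a *: x) = a *: U x.
Proof.
have U0 : U 0 = 0 by have := sideB 0 0; rewrite !subrr.
by have := side_linear hM a x 0; rewrite U0 !addr0.
Qed.

Lemma side_form_le x : `|B x x| <= hform x x.
Proof. by rewrite /B normrM side_normr mul1r reform_le_hform. Qed.

Lemma side_form_young (t : R) x y : 0 < t ->
  2 * `|B x y| <= t * hform x x + t^-1 * hform y y.
Proof.
move=> t0; have hx := hform_ge0 x; have hy := hform_ge0 y.
have ti : 0 <= t^-1 by rewrite invr_ge0 ltW.
rewrite -(ler_pXn2r (n := 2)) ?nnegrE ?mulr_ge0 ?addr_ge0 ?mulr_ge0 ?(ltW t0)//.
rewrite exprMn -normrX ger0_norm ?sqr_ge0// /B exprMn (side_sign hM) mul1r.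
have := reform_CauchySchwarz x y; have := sqr_ge0 (t * hform x x - t^-1 * hform y y).
have -> : (t * hform x x - t^-1 * hform y y) ^+ 2 =
  (t * hform x x + t^-1 * hform y y) ^+ 2 - 2 ^+ 2 * (hform x x * hform y y).
  by field; rewrite gt_eqF.
lra.
Qed.

Lemma side_pos : exists2 a : R, 0 < a & forall x, M x -> a * hform x x <= B x x.
Proof. by have [[_]] := side_max hM. Qed.

Lemma side_form_ge0 x : M x -> 0 <= B x x.
Proof.
have [a a0 ha] := side_pos => /ha; apply: le_trans.
by rewrite mulr_ge0 ?hform_ge0 ?(ltW a0).
Qed.

(** The closure of a uniformly definite subspace is uniformly definite, possibly
    with a smaller constant; hence a maximal one is closed. *)
Lemma side_closed l : adherent M l -> M l.
Proof.
have [a a0 ha] := side_pos; have LM := side_subspace.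
have [_ hmax] := side_max hM.
suff E : [set l | adherent M l] = M by move=> h; rewrite -E.
apply: hmax => [|x Mx e e0]; last first.
  by exists x => //; rewrite subrr (symform0l hS).
split.
  split; first by move=> e e0; exists 0; [by case: LM|rewrite subrr (symform0l hS)].
  move=> t x y ax ay e e0.
  have t0 : 0 < sqmod t + 1 by rewrite ltr_wpDl ?sqmod_ge0.
  have d0 : 0 < e / (4 * (sqmod t + 1)) by rewrite divr_gt0// mulr_gt0.
  have [m Mm xm] := ax _ d0.
  have [n Mn yn] := ay (e / 4) ltac:(by rewrite divr_gt0).
  exists (t *: m + n); first by case: LM => _; apply.
  rewrite opprD addrACA -scalerBr; apply: le_lt_trans (hform_sqrD _ _) _.
  rewrite hformZ.
  have h3 : sqmod t * (e / (4 * (sqmod t + 1))) <= e / 4.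
    have -> : e / 4 = (sqmod t + 1) * (e / (4 * (sqmod t + 1))) by field; rewrite gt_eqF.
    by rewrite ler_wpM2r ?(ltW d0)// lerDl.
  have := ler_wpM2l (sqmod_ge0 t) (ltW xm); lra.
exists (a / 4) => [|x ax]; first by rewrite divr_gt0.
apply/ler_addgt0Pl => e e0.
pose K := 4 / a + 1 + a; have K0 : 0 < K by rewrite /K !addr_gt0 ?divr_gt0.
have [m Mm xm] := ax _ (divr_gt0 e0 K0).
move: xm; set z := x - m => xm.
have mE : m = x - z by rewrite /z opprB addrC subrK.
have h1 := ha _ Mm.
have h2 : B m m = B x x - 2 * B x z + B z z by rewrite mE (symform_sqrB bS).
have h3 : hform x x <= 2 * hform m m + 2 * hform z z.
  by rewrite {1 2}(_ : x = m + z) ?hform_sqrD// mE subrK.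
have a40 : 0 < a / 4 by rewrite divr_gt0.
have := side_form_young x z a40; have := ler_norm (- B x z); rewrite normrN.
have := side_form_le z; have := ler_norm (B z z).
have h4 : K * hform z z < e by rewrite mulrC -ltr_pdivlMr.
have h5 : a * hform x x <= a * (2 * hform m m + 2 * hform z z).
  by rewrite ler_wpM2l// ltW.
rewrite invf_div; move: h4; rewrite /K -/(B x x); lra.
Qed.

Lemma side_hilbertian : hilbertian M B.
Proof.
have [a a0 ha] := side_pos; have LM := side_subspace.
have [_ _ _ cpl] := hform_hilbertian H.
split=> //; first exact: side_form_ge0.
  move=> x /ha + Bx; rewrite Bx pmulr_rle0// => hx.
  by apply: hform_eq0; apply/eqP; rewrite eq_le hx hform_ge0.
move=> u Mu cu.
have [//||l _ hl] := cpl u.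
  move=> e e0; have [N hN] := cu _ (mulr_gt0 a0 e0); exists N => m n Nm Nn.
  rewrite -(ltr_pM2l a0); apply: le_lt_trans (hN m n Nm Nn).
  by apply: ha; exact: subspaceB.
exists l => [|e e0].
  apply: side_closed => e e0; have [N hN] := hl _ e0.
  by exists (u N) => //; rewrite hformB; exact: hN.
have [N hN] := hl _ e0; exists N => n /hN; apply: le_lt_trans.
exact: le_trans (ler_norm _) (side_form_le _).
Qed.

Lemma side_form_bounded x y : (B x y) ^+ 2 <= hform x x * hform y y.
Proof. by rewrite /B exprMn (side_sign hM) mul1r; exact: reform_CauchySchwarz. Qed.

(** By the lower frame bound s U is coercive on M for the form s [.,.]. *)
Lemma side_onto m : M m -> exists2 x, M x & s%:C *: U x = m.
Proof.
have [a a0 ha] := side_pos; have [c c0 hc] := side_coercive hM.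
have [C C0 hC] := side_bounded hM => Mm.
apply: (@Lax_Milgram _ _ M B (fun x => s%:C *: U x) (C / a) c bS side_hilbertian) => //.
- by move=> t y z; rewrite (side_linear hM) scalerDr !scalerA mulrC.
- by move=> y _; exact: (subspaceZ s%:C side_subspace (side_range hM y)).
- move=> y My; suff -> : B (s%:C *: U y) y = reform (U y) y by exact: hc.
  by rewrite /B (symformZl rS) mulrA -expr2 (side_sign hM) mul1r.
- move=> y My; apply: le_trans (ler_norm _) _; apply: le_trans (side_form_le _) _.
  rewrite hformZ sqmodE /= expr0n addr0 (side_sign hM) mul1r.
  apply: le_trans (hC _) _; rewrite -mulrA ler_wpM2l ?(ltW C0)//.
  by rewrite ler_pdivlMl// ha.
Qed.

(** The operator s U maps M onto M, and composing the inverse with U gives the orthogonal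
    projection onto M along ker U. *)
Lemma side_proj x : exists2 m, M m & U (x - m) = 0.
Proof.
have [m Mm Em] := side_onto (subspaceZ s%:C side_subspace (side_range hM x)).
exists m => //; rewrite sideB; apply/eqP; rewrite subr_eq0; apply/eqP.
have := congr1 (fun z => s%:C *: z) Em; rewrite /= !scalerA -rmorphM /= -expr2.
by rewrite (side_sign hM) rmorph1 !scale1r.
Qed.

Lemma side_ker_subspace : linear_subspace [set n | U n = 0].
Proof.
split=> /= [|a x y x0 y0]; last by rewrite (side_linear hM) x0 y0 scaler0 addr0.
by have := sideB 0 0; rewrite !subrr.
Qed.

(** U is symmetric and maps M onto M. *)
Lemma side_orth m n : M m -> U n = 0 -> reform m n = 0.
Proof.
move=> /side_onto[x _ <-] Un.
by rewrite (symformZl rS) (side_sym hM) Un (symform0r rS) mulr0.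
Qed.

Lemma side_ker_orth m n : U n = 0 -> M m -> reform n m = 0.
Proof. by move=> Un Mm; rewrite (symformC rS) side_orth. Qed.

Lemma side_ker_korth h m : U h = 0 -> M m -> kform h m = 0.
Proof.
move=> Uh Mm; apply: kform_eq0; first exact: side_ker_orth.
by rewrite imform_reform; apply: side_ker_orth => //; rewrite sideZ Uh scaler0.
Qed.

(** If s [n, n] were positive, the span of M and n would still be uniformly definite,
    as n is orthogonal to M; this contradicts the maximality of M. *)
Lemma side_ker_le0 n : U n = 0 -> B n n <= 0.
Proof.
move=> Un; rewrite leNgt; apply/negP => Bn.
have [a a0 ha] := side_pos; have [_ hmax] := side_max hM.
have LM := side_subspace.
pose L := [set x | exists2 m, M m & exists t : R[i], x = m + t *: n].
have n0 : 0 < hform n n.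
  rewrite lt_def hform_ge0 andbT; apply: contraTneq Bn => /hform_eq0 ->.
  by rewrite /B (symform0l rS) mulr0 ltxx.
have LL : L = M.
  apply: hmax => [|x Mx]; last by exists x => //; exists 0; rewrite scale0r addr0.
  split.
    split; first by exists 0; [case: LM|exists 0; rewrite scale0r addr0].
    move=> b x y [m Mm [t ->]] [m' Mm' [t' ->]].
    exists (b *: m + m'); first by case: LM => _; exact.
    by exists (b * t + t'); rewrite scalerDr scalerA scalerDl addrACA.
  pose d := B n n / hform n n.
  have d0 : 0 < d by rewrite divr_gt0.
  exists (Num.min a d / 2) => [|x [m Mm [t ->]]]; first by rewrite divr_gt0// lt_min a0.
  have tn : B m (t *: n) = 0 by rewrite /B side_orth ?mulr0// sideZ Un scaler0.
  rewrite -[leRHS]/(B (m + t *: n) (m + t *: n)) (symform_sqrD bS) tn mulr0 addr0.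
  have h1 : d * hform (t *: n) (t *: n) = B (t *: n) (t *: n).
    by rewrite hformZ /B reformZ /d /B; field; rewrite gt_eqF.
  have h2 := ha m Mm; have h3 := hform_sqrD m (t *: n).
  have h4 : Num.min a d * hform m m <= a * hform m m.
    by rewrite ler_wpM2r ?hform_ge0// ge_min lexx.
  have h5 : Num.min a d * hform (t *: n) (t *: n) <= d * hform (t *: n) (t *: n).
    by rewrite ler_wpM2r ?hform_ge0// ge_min lexx orbT.
  have : Num.min a d / 2 * hform (m + t *: n) (m + t *: n) <=
      Num.min a d / 2 * (2 * hform m m + 2 * hform (t *: n) (t *: n)).
    by rewrite ler_wpM2l// ltW// divr_gt0// lt_min a0.
  lra.
have Mn : M n by rewrite -LL; exists 0; [case: LM|exists 1; rewrite add0r scale1r].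
by move: Bn; rewrite /B side_orth// mulr0 ltxx.
Qed.

(** For n in ker U let g be the component in ker U of the fundamental symmetry
    applied to n. Then [n, g] is the squared norm of n, and the Cauchy-Schwarz
    inequality for the semidefinite form on ker U turns this into a lower bound
    for -s [n, n]. *)
Lemma side_ker_definite : exists2 b : R, 0 < b &
  forall n, U n = 0 -> b * hform n n <= - B n n.
Proof.
have [a a0 ha] := side_pos; have [c c0 hc] := side_coercive hM.
have [C C0 hC] := side_bounded hM.
pose K := 2 + 2 * (C / (c * a) ^+ 2).
have ca0 : 0 < (c * a) ^+ 2 by rewrite exprn_gt0// mulr_gt0.
have K0 : 0 < K by rewrite /K ltr_wpDr// mulr_ge0// divr_ge0 ?ltW.
exists K^-1 => [|n Un]; first by rewrite invr_gt0.
have [m Mm Um] := side_proj (krein_sym n).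
set g := krein_sym n - m in Um.
have hn := hform_ge0 n; have hm := hform_ge0 m.
have mC : (c * a) ^+ 2 * hform m m <= C * hform n n.
  apply: ler_of_sqr => //; first by rewrite mulr_ge0 ?(ltW C0).
  have h1 : c * a * hform m m <= reform (U (krein_sym n)) m.
    have -> : U (krein_sym n) = U m.
      by apply/eqP; rewrite -subr_eq0 -sideB -/g Um.
    by apply: le_trans (hc m Mm); rewrite -mulrA ler_wpM2l ?(ltW c0)// ha.
  apply: (@le_trans _ _ ((reform (U (krein_sym n)) m) ^+ 2)).
    rewrite ler_pXn2r// nnegrE; last apply: le_trans h1;
      by rewrite mulr_ge0// mulr_ge0// ltW.
  apply: le_trans (reform_CauchySchwarz _ _) _; rewrite mulrC ler_wpM2l//.
  by rewrite -(hform_krein_sym n) hC.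
have gK : hform g g <= K * hform n n.
  apply: le_trans (hform_sqrD _ _) _; rewrite hformN hform_krein_sym /K.
  have : hform m m <= C / (c * a) ^+ 2 * hform n n.
    by rewrite mulrAC ler_pdivlMr// mulrC.
  lra.
have cs : (B n g) ^+ 2 <= - B n n * - B g g.
  have nS : symform (fun x y => - B x y).
    split=> [x y|x y z|t x z]; first by rewrite (symformC bS).
      by rewrite (symformDl bS) opprD.
    by rewrite (symformZl bS) mulrN.
  rewrite -[X in X ^+ 2]opprK sqrrN.
  apply: (symform_CauchySchwarz nS side_ker_subspace) => //= z /side_ker_le0.
  by rewrite oppr_ge0.
have ng : (B n g) ^+ 2 = (hform n n) ^+ 2.
  rewrite /B /g (symformDr rS) (symformNr rS) (side_ker_orth Un Mm) oppr0 addr0.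
  by rewrite -hform_reform exprMn (side_sign hM) mul1r.
have Bg : - B g g <= K * hform n n.
  by apply: le_trans gK; apply: le_trans (ler_norm _) _; rewrite normrN side_form_le.
have [h0|h0] := eqVneq (hform n n) 0.
  by rewrite h0 mulr0 oppr_ge0 side_ker_le0.
have hp : 0 < hform n n by rewrite lt_def h0.
rewrite ler_pdivrMl// -(ler_pM2r hp) -expr2 -ng; apply: le_trans cs _.
rewrite mulrAC [leRHS]mulrC; apply: ler_wpM2l => //.
by rewrite oppr_ge0 side_ker_le0.
Qed.

End One_side.

(** * Invertibility of the frame operator *)

Section Two_sides.
Variables (R : realType) (H : kreinSpace R).
Variables (s : R) (M M' : set H) (U U' S : H -> H).
Hypothesis hM : frame_side s M U.
Hypothesis hM' : frame_side (- s) M' U'.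
Hypothesis SE : forall x, S x = s%:C *: (U x - U' x).
Implicit Types (x y : H).

Let B x y := s * reform x y.
Let rS := @reform_sym R H.
Let hS := @hform_sym R H.
Let bS : symform B := @side_form_sym R H s.

Lemma frame_opL (a : R[i]) x y : S (a *: x + y) = a *: S x + S y.
Proof.
rewrite !SE (side_linear hM) (side_linear hM') opprD addrACA.
by rewrite -scalerBr scalerDr !scalerA mulrC.
Qed.

Lemma frame_opB x y : S (x - y) = S x - S y.
Proof. by rewrite addrC -scaleN1r frame_opL scaleN1r addrC. Qed.

Lemma frame_op_sym x y : reform (S x) y = reform x (S y).
Proof.
rewrite !SE (symformZl rS) (symformZr rS) (symformDl rS) (symformDr rS).
by rewrite (symformNl rS) (symformNr rS) (side_sym hM) (side_sym hM').
Qed.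

Lemma frame_op_kform x y : kform (S x) y = kform x (S y).
Proof.
apply/eqP; rewrite eq_complex; apply/andP; split; apply/eqP.
  exact: frame_op_sym.
have S0 : S 0 = 0 by have := frame_opB 0 0; rewrite !subrr.
have := frame_op_sym ((0 -i* 1) *: x) y.
have := frame_opL (0 -i* 1) x 0.
by rewrite S0 !addr0 => ->; rewrite -!imform_reform.
Qed.

Lemma frame_op_bounded : exists2 C : R, 0 < C & forall x, hform (S x) (S x) <= C * hform x x.
Proof.
have [C C0 hC] := side_bounded hM; have [C' C'0 hC'] := side_bounded hM'.
exists (2 * C + 2 * C') => [|x]; first by rewrite addr_gt0 ?mulr_gt0.
rewrite SE hformZ sqmodE /= expr0n addr0 (side_sign hM) mul1r.
apply: le_trans (hform_sqrD _ _) _; rewrite hformN.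
have := hC x; have := hC' x; lra.
Qed.

(** If m + m' is small then [m, m] and [m', m'] nearly agree; but they have opposite
    signs and control the norms of m and m'. *)
Lemma side_angle : exists2 c : R, 0 < c & forall m m', M m -> M' m' ->
  c * (hform m m + hform m' m') <= hform (m + m') (m + m').
Proof.
have [a a0 ha] := side_pos hM; have [a' a'0 ha'] := side_pos hM'.
pose d := Num.min a a'; have d0 : 0 < d by rewrite lt_min a0.
exists (d ^+ 2 / 2) => [|m m' Mm Mm']; first by rewrite divr_gt0 ?exprn_gt0.
have := ha m Mm; have := ha' m' Mm'; rewrite mulNr => h1 h2.
have hm := hform_ge0 m; have hm' := hform_ge0 m'.
have h3 : d * hform m m <= a * hform m m by rewrite ler_wpM2r// ge_min lexx.
have h4 : d * hform m' m' <= a' * hform m' m' by rewrite ler_wpM2r// ge_min lexx orbT.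
set z := hform m m + hform m' m'.
have z0 : 0 <= z by rewrite addr_ge0.
have E : B (m + m') (m - m') = B m m - B m' m'.
  by rewrite (symformDl bS) !(symformDr bS) !(symformNr bS) (symformC bS m' m); ring.
have h5 : d * z <= B (m + m') (m - m') by rewrite E /z /B; lra.
have h6 : d ^+ 2 * z <= 2 * hform (m + m') (m + m').
  apply: ler_of_sqr => //; first by rewrite mulr_ge0 ?hform_ge0.
  apply: (@le_trans _ _ ((B (m + m') (m - m')) ^+ 2)).
    rewrite ler_pXn2r// nnegrE; last apply: le_trans h5; by rewrite mulr_ge0// ltW.
  apply: le_trans (side_form_bounded hM _ _) _.
  have h7 : hform (m - m') (m - m') <= 2 * z.
    by apply: le_trans (hform_sqrD _ _) _; rewrite hformN /z mulrDr.
  have := ler_wpM2l (hform_ge0 (m + m')) h7; lra.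
lra.
Qed.

Lemma side_disjoint m : M m -> M' m -> m = 0.
Proof.
move=> Mm M'm; have [c c0 hc] := side_angle.
have := hc m (- m) Mm (subspaceN (side_subspace hM') M'm).
rewrite subrr (symform0l hS) pmulr_rle0// hformN => h.
by apply: hform_eq0; apply/eqP; rewrite eq_le hform_ge0 andbT; lra.
Qed.

(** S f splits into its components in M and M', each of which controls the
    projection of f onto the corresponding subspace; a vector whose projections
    onto both M and M' are small is itself small, because its remaining part
    would be of both signs. *)
Lemma frame_op_bounded_below : exists2 c : R, 0 < c &
  forall x, c * hform x x <= hform (S x) (S x).
Proof.
have [k k0 hk] := side_angle.
have [a a0 ha] := side_pos hM; have [a' a'0 ha'] := side_pos hM'.
have [c c0 hc] := side_coercive hM; have [c' c'0 hc'] := side_coercive hM'.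
have [b b0 hb] := side_ker_definite hM.
have low (m V : H) w : 0 < w -> w * hform m m <= reform V m ->
    w ^+ 2 * hform m m <= hform V V.
  move=> w0 h; apply: ler_of_sqr; rewrite ?hform_ge0//.
  apply: (@le_trans _ _ ((reform V m) ^+ 2)); last by rewrite mulrC reform_CauchySchwarz.
  have h0 : 0 <= w * hform m m by rewrite mulr_ge0 ?hform_ge0 ?(ltW w0).
  by rewrite ler_pXn2r// nnegrE (le_trans h0 h).
have low1 m : M m -> (c * a) ^+ 2 * hform m m <= hform (U m) (U m).
  move=> Mm; apply: low; first by rewrite mulr_gt0.
  by apply: le_trans (hc _ Mm); rewrite -mulrA ler_wpM2l ?(ltW c0)// ha.
have low2 m : M' m -> (c' * a') ^+ 2 * hform m m <= hform (U' m) (U' m).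
  move=> Mm; apply: low; first by rewrite mulr_gt0.
  by apply: le_trans (hc' _ Mm); rewrite -mulrA ler_wpM2l ?(ltW c'0)// ha'.
pose q := Num.min ((c * a) ^+ 2) ((c' * a') ^+ 2).
have q0 : 0 < q by rewrite lt_min !exprn_gt0// mulr_gt0.
pose K := 2 + 2 / b.
have K0 : 0 < K by rewrite /K addr_gt0// divr_gt0.
exists (k * q / K) => [|x]; first by rewrite !divr_gt0// mulr_gt0.
have [m Mm Um] := side_proj hM x; have [m' Mm' Um'] := side_proj hM' x.
set n := x - m in Um; set n' := x - m' in Um'.
have xK : hform x x <= K * (hform m m + hform m' m').
  have E1 : B x x = B m m + B n n.
    have -> : x = m + n by rewrite /n addrC subrK.
    by rewrite (symform_sqrD bS) /B (side_orth hM Mm Um) !mulr0 addr0.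
  have E2 : B x x = B m' m' + B n' n'.
    have -> : x = m' + n' by rewrite /n' addrC subrK.
    by rewrite (symform_sqrD bS) /B (side_orth hM' Mm' Um') !mulr0 addr0.
  have h1 := hb n Um; have := side_ker_le0 hM' Um'.
  rewrite mulNr oppr_le0 => h2.
  have h3 : B m m <= hform m m by apply: le_trans (ler_norm _) (side_form_le hM _).
  have h4 : - B m' m' <= hform m' m'.
    by apply: le_trans (ler_norm _) _; rewrite normrN (side_form_le hM).
  have h5 : hform n n <= (hform m m + hform m' m') / b.
    rewrite ler_pdivlMr// mulrC; move: h1 h2 E1 E2 h3 h4; rewrite /B; lra.
  have := hform_sqrD m n; rewrite {1 2}/n addrC subrK /K.
  have := hform_ge0 m'; lra.
have -> : S x = (s%:C *: U m) + (- s)%:C *: U' m'.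
  have -> : U m = U x.
    by apply/esym/eqP; rewrite -subr_eq0 -(sideB hM) -/n Um.
  have -> : U' m' = U' x.
    by apply/esym/eqP; rewrite -subr_eq0 -(sideB hM') -/n' Um'.
  by rewrite SE scalerBr rmorphN scaleNr.
have Z (e : R) (v : H) : e ^+ 2 = 1 -> hform (e%:C *: v) (e%:C *: v) = hform v v.
  by move=> e1; rewrite hformZ sqmodE /= expr0n addr0 e1 mul1r.
apply: le_trans (hk _ _ _ _); last first.
- exact: subspaceZ (side_subspace hM') (side_range hM' _).
- exact: subspaceZ (side_subspace hM) (side_range hM _).
rewrite (Z _ _ (side_sign hM)) (Z _ _ (side_sign hM')).
rewrite -!mulrA ler_wpM2l ?(ltW k0)//.
have h1 := low1 m Mm; have h2 := low2 m' Mm'.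
have h3 : q * hform m m <= (c * a) ^+ 2 * hform m m.
  by rewrite ler_wpM2r ?hform_ge0// ge_min lexx.
have h4 : q * hform m' m' <= (c' * a') ^+ 2 * hform m' m'.
  by rewrite ler_wpM2r ?hform_ge0// ge_min lexx orbT.
have : K^-1 * hform x x <= hform m m + hform m' m' by rewrite ler_pdivrMl.
move/(ler_wpM2l (ltW q0)); lra.
Qed.

Lemma frame_op_onto y : exists x, S x = y.
Proof.
have [C _ hC] := frame_op_bounded; have [c c0 hc] := frame_op_bounded_below.
exact: (surjective_of_bounded_below frame_opL frame_opL frame_op_sym hC hC c0 hc).
Qed.

Lemma frame_op_inj x y : S x = S y -> x = y.
Proof.
have [c c0 hc] := frame_op_bounded_below => E; apply/eqP; rewrite -subr_eq0.
apply/eqP/hform_eq0/eqP; rewrite eq_le hform_ge0 andbT -(pmulr_rle0 _ c0).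
by apply: le_trans (hc _) _; rewrite frame_opB E subrr (symform0l hS).
Qed.

Lemma frame_op_ker h : U' h = 0 -> S h = s%:C *: U h.
Proof. by rewrite SE => ->; rewrite subr0. Qed.

Lemma frame_op_ker_range h : U' h = 0 -> M (S h).
Proof.
by move/frame_op_ker ->; exact: subspaceZ (side_subspace hM) (side_range hM _).
Qed.

(** If S x = m then U' x lies in both M and M', hence vanishes. *)
Lemma frame_op_ker_onto m : M m -> exists2 h, U' h = 0 & S h = m.
Proof.
move=> Mm; have [x Sx] := frame_op_onto m; exists x => //.
have sN := side_sign_neq0 hM.
have E : s%:C *: U' x = s%:C *: U x - m by rewrite -Sx SE scalerBr opprB addrC subrK.
have : s%:C *: U' x = 0.
  apply: side_disjoint; last exact: subspaceZ (side_subspace hM') (side_range hM' _).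
  rewrite E; apply: subspaceB (side_subspace hM) _ Mm.
  exact: subspaceZ (side_subspace hM) (side_range hM _).
move/eqP; rewrite scaler_eq0 => /orP[|/eqP//].
by rewrite -[0]/(0%:C) (inj_eq (@complexI _)) (negbTE sN).
Qed.

(** For the h in ker U' with S h = s U x, the vector x - h lies in ker U. *)
Lemma frame_op_kernels x : exists2 h, U' h = 0 & U (x - h) = 0.
Proof.
have sN := side_sign_neq0 hM.
have sC : s%:C != 0 :> R[i] by rewrite -[0]/(0%:C) (inj_eq (@complexI _)).
have [h hh Sh] := frame_op_ker_onto (subspaceZ s%:C (side_subspace hM) (side_range hM x)).
exists h => //; rewrite (sideB hM); apply/eqP; rewrite subr_eq0 eq_sym; apply/eqP.
by apply: (scalerI sC); rewrite -Sh frame_op_ker.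
Qed.

End Two_sides.

(** * Consequences of the frame bounds *)

Section Bounds_on_kernel.
Variables (R : realType) (H : kreinSpace R).
Variables (s : R) (M M' : set H) (U U' S : H -> H).
Hypothesis hM : frame_side s M U.
Hypothesis hM' : frame_side (- s) M' U'.
Hypothesis SE : forall x, S x = s%:C *: (U x - U' x).
Implicit Types (x y h : H).

Let B x y := s * reform x y.
Let rS := @reform_sym R H.
Let bS : symform B := @side_form_sym R H s.

Lemma kernel_ge0 h : U' h = 0 -> 0 <= B h h.
Proof. by move/(side_ker_le0 hM'); rewrite mulNr oppr_le0. Qed.

Lemma frame_op_form h x : U' h = 0 -> B (S h) x = reform (U h) x.
Proof.
move/(frame_op_ker SE) ->.
by rewrite /B (symformZl rS) mulrA -expr2 (side_sign hM) mul1r.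
Qed.

(** The component of h along M has a form at least as large as that of h, because the
    other component lies in ker U, where the form has the opposite sign. *)
Lemma kernel_lower_bound (k : R) h :
  (forall m, M m -> k * B m m <= reform (U m) m) -> 0 <= k -> U' h = 0 ->
  k * B h h <= B (S h) h.
Proof.
move=> hk k0 Uh; rewrite frame_op_form//.
have [m Mm Um] := side_proj hM h; have := side_ker_le0 hM Um.
set n := h - m in Um * => n0.
have hE : h = m + n by rewrite /n addrC subrK.
have -> : U h = U m by apply/eqP; rewrite -subr_eq0 -(sideB hM) -/n Um.
have -> : reform (U m) h = reform (U m) m.
  by rewrite hE (symformDr rS) [X in _ + X](side_sym hM) Um (symform0r rS) addr0.
apply: le_trans (hk m Mm); rewrite ler_wpM2l// hE (symform_sqrD bS).
by rewrite {2}/B (side_orth hM Mm Um) !mulr0 addr0 gerDl.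
Qed.

(** Cauchy-Schwarz for S h and the component m of h along M: [S h, h] = [S h, m], and
    k s [m, m] is at most s [S h, h]. *)
Lemma range_lower_bound (k : R) h :
  (forall m, M m -> k * B m m <= reform (U m) m) -> 0 < k -> U' h = 0 ->
  k * B (S h) h <= B (S h) (S h).
Proof.
move=> hk k0 Uh; have MS : M (S h) by exact: (frame_op_ker_range hM SE).
have [m Mm Um] := side_proj hM h.
have UE : U h = U m by apply/eqP; rewrite -subr_eq0 -(sideB hM) Um.
have E : B (S h) h = B (S h) m.
  have -> : B (S h) h = B (S h) (m + (h - m)) by rewrite addrC subrK.
  rewrite (symformDr bS).
  by rewrite {2}/B (side_orth hM MS Um) mulr0 addr0.
have a0 : 0 <= B (S h) h by rewrite frame_op_form// (side_ge0 hM).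
have SS := side_form_ge0 hM MS.
have hm : k * B m m <= B (S h) h by rewrite E frame_op_form// UE hk.
have cs : (B (S h) h) ^+ 2 <= B (S h) (S h) * B m m.
  rewrite E; apply: (symform_CauchySchwarz bS (side_subspace hM)) => //.
  by move=> z /(side_form_ge0 hM).
have [a1|a1] := eqVneq (B (S h) h) 0; first by rewrite a1 mulr0.
have ap : 0 < B (S h) h by rewrite lt_def a1.
rewrite -(ler_pM2r ap) -mulrA -expr2; apply: le_trans (_ : k * (B (S h) (S h) * B m m) <= _).
  by rewrite ler_wpM2l// ltW.
by rewrite mulrCA ler_wpM2l.
Qed.

(** For h in ker U', let f be the projection of S h onto ker U'. The preimage of
    f under S differs from h by an element of ker U, hence the dual analysis
    quantity of f is [S h, h], which is also [f, h]. *)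
Lemma dual_vector h : U' h = 0 -> exists f u,
  [/\ U' f = 0, S u = f, U u = U h, reform (U u) u = B (S h) h &
      B f h = B (S h) h].
Proof.
move=> Uh; have [m Mm Um] := side_proj hM' (S h).
have SE' x : S x = (- s)%:C *: (U' x - U x).
  by rewrite SE rmorphN scaleNr -scalerN opprB.
have hMs : frame_side (- - s) M U by rewrite opprK.
have [w Uw Sw] := frame_op_ker_onto hM' hMs SE' Mm.
exists (S h - m), (h - w); split=> //.
- by rewrite (frame_opB hM hM' SE) Sw.
- by rewrite (sideB hM) Uw subr0.
- rewrite (sideB hM) Uw subr0 (symformDr rS) (symformNr rS).
  by rewrite [X in _ - X](side_sym hM) Uw (symform0r rS) subr0 frame_op_form.
- rewrite (symformDl bS) (symformNl bS) {2}/B.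
  by rewrite (side_orth hM' Mm Uh) mulr0 subr0.
Qed.

(** Cauchy-Schwarz for h and the vector f associated with it, for which the dual
    frame bound reads g s [f, f] <= s [S h, h] = s [f, h]. *)
Lemma dual_lower_bound (g : R) h :
  (forall f u, U' f = 0 -> S u = f -> g * B f f <= reform (U u) u) -> 0 < g ->
  U' h = 0 -> g * B (S h) h <= B h h.
Proof.
move=> hg g0 Uh; have [f [u [Uf Su _ E1 E2]]] := dual_vector Uh.
have a0 : 0 <= B (S h) h by rewrite frame_op_form// (side_ge0 hM).
have p0 := kernel_ge0 Uh.
have hf := hg f u Uf Su.
have cs : (B f h) ^+ 2 <= B f f * B h h.
  by apply: (symform_CauchySchwarz bS (side_ker_subspace hM')) => //; exact: kernel_ge0.
have [a1|a1] := eqVneq (B (S h) h) 0; first by rewrite a1 mulr0.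
have ap : 0 < B (S h) h by rewrite lt_def a1.
rewrite -(ler_pM2r ap) -mulrA -expr2 -E2; apply: le_trans (_ : g * (B f f * B h h) <= _).
  by rewrite ler_wpM2l// ltW.
by rewrite mulrA mulrC ler_wpM2l// E2 -E1.
Qed.

(** Optimisation of the nonnegative number [U v, v] over v = u - t w with
    S w = h and u as above. *)
Lemma dual_upper_bound (d : R) h :
  (forall f u, U' f = 0 -> S u = f -> reform (U u) u <= d * B f f) -> 0 < d ->
  U' h = 0 -> B h h <= d * B (S h) h.
Proof.
move=> hd d0 Uh; have [f [u [Uf Su UE E1 E2]]] := dual_vector Uh.
have [w Sw] := frame_op_onto hM hM' SE h.
have hw := hd h w Uh Sw.
have := side_ge0 hM (u - (d^-1)%:C *: w).
rewrite (sideB hM) (sideZ hM) (symformDl rS) (symformNl rS) (symformZl rS).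
rewrite !(symformDr rS) !(symformNr rS) !(symformZr rS).
have E3 : reform (U u) w = B h h.
  by rewrite UE -frame_op_form// /B (frame_op_sym hM hM' SE) Sw.
have -> : reform (U w) u = B h h by rewrite (side_sym hM) (symformC rS) E3.
rewrite E3 E1 => pos.
have : d^-1 * (d^-1 * reform (U w) w) <= d^-1 * (d^-1 * (d * B h h)).
  by do 2!(rewrite ler_wpM2l ?invr_ge0 ?(ltW d0)//).
have -> : d^-1 * (d^-1 * (d * B h h)) = d^-1 * B h h by field; rewrite gt_eqF.
move=> up; rewrite -ler_pdivrMl//; lra.
Qed.

End Bounds_on_kernel.

(** * Lower bounds and the resolvent set *)

Section Resolvent.
Variables (R : realType) (H : kreinSpace R).
Implicit Types (x y : H).

Let rS := @reform_sym R H.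
Let hS := @hform_sym R H.

Definition bounded_below_shift (S : H -> H) (l : R[i]) :=
  exists2 c : R, 0 < c & forall x,
    c * hform x x <= hform (S x - l *: x) (S x - l *: x).

(** The Krein adjoint of S - l is S minus the conjugate of l, whose lower bound makes
    S - l onto; the lower bound of S - l itself makes the inverse continuous. *)
Lemma resolvent_of_bounded_below (S : H -> H) (C c : R) (l : R[i]) :
  (forall a x y, S (a *: x + y) = a *: S x + S y) ->
  (forall x y, reform (S x) y = reform x (S y)) ->
  (forall x, hform (S x) (S x) <= C * hform x x) -> 0 <= C -> 0 < c ->
  (forall x, c * hform x x <= hform (S x - l *: x) (S x - l *: x)) ->
  (forall x, c * hform x x <=
     hform (S x - Num.conj l *: x) (S x - Num.conj l *: x)) ->
  resolvent_set S l.
Proof.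
move=> SL Ssym hC C0 c0 low low'.
pose T k x := S x - k *: x.
have TL k a x y : T k (a *: x + y) = a *: T k x + T k y.
  rewrite /T SL scalerDr scalerBr opprD addrACA !scalerA.
  by rewrite [k * a]mulrC.
have sqJ (k : R[i]) : sqmod (Num.conj k) = sqmod k.
  by rewrite !sqmodE ReJ ImJ sqrrN.
have Tb k x : sqmod k = sqmod l -> hform (T k x) (T k x) <= (2 * C + 2 * sqmod l) * hform x x.
  move=> kl; apply: le_trans (hform_sqrD _ _) _; rewrite hformN hformZ kl.
  have := hC x; lra.
have adj x y : reform (T l x) y = reform x (T (Num.conj l) y).
  rewrite /T (symformDl rS) (symformDr rS) (symformNl rS) (symformNr rS) Ssym.
  congr (_ - _); rewrite reformZl [RHS](symformC rS) reformZl ReJ ImJ.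
  by rewrite (symformC rS x) (imformC x); ring.
have onto y : exists x, T l x = y.
  apply: (surjective_of_bounded_below (TL l) (TL (Num.conj l)) adj _ _ c0) => //.
    by move=> x; apply: Tb.
  by move=> x; apply: Tb; exact: sqJ.
have TB x y : T l (x - y) = T l x - T l y.
  by rewrite addrC -scaleN1r TL scaleN1r addrC.
have inj x y : T l x = T l y -> x = y.
  move=> E; apply/eqP; rewrite -subr_eq0; apply/eqP/hform_eq0/eqP.
  rewrite eq_le hform_ge0 andbT -(pmulr_rle0 _ c0).
  by apply: le_trans (low _) _; rewrite -/(T l _) TB E subrr (symform0l hS).
pose V y := projT1 (cid (onto y)).
have TV y : T l (V y) = y by exact: (projT2 (cid (onto y))).
have VL : linear V by move=> a x y; apply: inj; rewrite TL !TV.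
pose lV : {linear H -> H} := HB.pack V (GRing.isLinear.Build _ _ _ _ V VL).
exists lV; split; last 2 first.
- by move=> x; apply: inj; rewrite TV.
- by move=> y; exact: TV.
move=> x; have FF := @nbhs_filter H x.
apply/(@cvgrPdist_lt _ _ _ _ FF) => e e0.
have re0 : 0 < complex.Re e by move: e0; rewrite ltcE => /andP[].
have sc : 0 < Num.sqrt c by rewrite sqrtr_gt0.
have d0 : (0 : R[i]) < (complex.Re e * Num.sqrt c)%:C by rewrite ltcR mulr_gt0.
apply/nbhs_ballP; exists (complex.Re e * Num.sqrt c)%:C => // y.
rewrite -ball_normE /= norm_lt_hform//= exprMn sqr_sqrtr ?(ltW c0)// => xy.
rewrite norm_lt_hform// -(ltr_pM2l c0) mulrC [ltRHS]mulrC.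
apply: le_lt_trans xy; rewrite mulrC.
have -> : V x - V y = V (x - y) by apply: inj; rewrite TB !TV.
by apply: le_trans (low _) _; rewrite -/(T l _) TV.
Qed.

(** Cauchy-Schwarz for [g, v]: the squared norm of v is at most a multiple of D, so
    that [g, v] >= e D is possible only if the squared norm of g is at least another
    multiple of D, which in turn dominates the squared norm of f. *)
Lemma test_vector_bound (D e b : R) (f g v : H) : 0 <= D -> 0 < b -> 0 < e ->
  hform f f <= 2 / b * D -> hform v v <= 2 / b * D -> e * D <= reform g v ->
  (e * b / 2) ^+ 2 * hform f f <= hform g g.
Proof.
move=> D0 b0 e0 fD vD gv; have g0 := hform_ge0 g.
have eD : 0 <= e * D by rewrite mulr_ge0 ?(ltW e0).
have est : e ^+ 2 * D <= 2 / b * hform g g.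
  apply: ler_of_sqr => //; first by rewrite mulr_ge0 ?divr_ge0 ?(ltW b0).
  apply: (@le_trans _ _ ((reform g v) ^+ 2)).
    by rewrite ler_pXn2r// nnegrE (le_trans eD gv).
  apply: le_trans (reform_CauchySchwarz _ _) _.
  have := ler_wpM2l g0 vD; lra.
apply: (@le_trans _ _ (b / 2 * (e ^+ 2 * D))).
  have -> : b / 2 * (e ^+ 2 * D) = (e * b / 2) ^+ 2 * (2 / b * D).
    by field; rewrite gt_eqF.
  by rewrite ler_wpM2l// sqr_ge0.
have -> : hform g g = b / 2 * (2 / b * hform g g) by field; rewrite gt_eqF.
by rewrite ler_wpM2l// divr_ge0 ?(ltW b0).
Qed.

End Resolvent.

(** * Real shifts *)

Section Real_shifts.
Variables (R : realType) (H : kreinSpace R).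
Variables (s : R) (M M' : set H) (U U' S : H -> H).
Hypothesis hM : frame_side s M U.
Hypothesis hM' : frame_side (- s) M' U'.
Hypothesis SE : forall x, S x = s%:C *: (U x - U' x).
Implicit Types (x y h : H).

Let B x y := s * reform x y.
Let rS := @reform_sym R H.
Let bS : symform B := @side_form_sym R H s.

Let SE' x : S x = (- s)%:C *: (U' x - U x).
Proof. by rewrite SE rmorphN scaleNr -scalerN opprB. Qed.

Lemma form_test (g v : H) : B g v = reform g (s%:C *: v).
Proof. by rewrite (symformZr rS). Qed.

Lemma hform_sign (v : H) : hform (s%:C *: v) (s%:C *: v) = hform v v.
Proof. by rewrite hformZ sqmodE /= expr0n addr0 (side_sign hM) mul1r. Qed.

Lemma hform_sum_le (b : R) x y p q : 0 < b ->
  b * hform x x <= p -> b * hform y y <= q ->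
  hform (x + y) (x + y) <= 2 / b * (p + q) /\
  hform (x - y) (x - y) <= 2 / b * (p + q).
Proof.
move=> b0 hx hy; have E : 2 * hform x x + 2 * hform y y <= 2 / b * (p + q).
  by rewrite -mulrDr -mulrA ler_wpM2l// ler_pdivlMl// mulrDr lerD.
split; apply: le_trans E; first exact: hform_sqrD.
by apply: le_trans (hform_sqrD _ _) _; rewrite hformN.
Qed.

(** Testing (S - r) (h + y) against h - y, where h and y are the components in
    ker U' and ker U, cancels the mixed terms. *)
Lemma bounded_below_real_lt (k k' r : R) : r < k -> r < k' ->
  (forall h, U' h = 0 -> k * B h h <= B (S h) h) ->
  (forall y, U y = 0 -> k' * - B y y <= - B (S y) y) ->
  bounded_below_shift S r%:C.
Proof.
move=> rk rk' hk hk'.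
have [b1 b10 hb1] := side_ker_definite hM'; have [b2 b20 hb2] := side_ker_definite hM.
pose b := Num.min b1 b2; have b0 : 0 < b by rewrite lt_min b10.
pose e := Num.min (k - r) (k' - r).
have e0 : 0 < e by rewrite lt_min !subr_gt0 rk.
exists ((e * b / 2) ^+ 2) => [|f]; first by rewrite exprn_gt0// divr_gt0// mulr_gt0.
have [h Uh Uy] := frame_op_kernels hM hM' SE f; set y := f - h in Uy.
have hb : b * hform h h <= B h h.
  apply: (@le_trans _ _ (b1 * hform h h)); first by rewrite ler_wpM2r ?hform_ge0// ge_min lexx.
  by have := hb1 h Uh; rewrite mulNr opprK.
have yb : b * hform y y <= - B y y.
  by apply: le_trans (hb2 y Uy); rewrite ler_wpM2r ?hform_ge0// ge_min lexx orbT.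
have [fb vb] := hform_sum_le b0 hb yb.
have fE : f = h + y by rewrite /y addrC subrK.
clearbody y.
have hy0 : B (S h) y = 0.
  by rewrite /B (side_orth hM (frame_op_ker_range hM SE Uh) Uy) mulr0.
have yh0 : B (S y) h = 0.
  by rewrite /B (side_orth hM' (frame_op_ker_range hM' SE' Uy) Uh) mulr0.
set D := B h h + - B y y in fb vb.
have p0 : 0 <= B h h by apply: le_trans hb; rewrite mulr_ge0 ?hform_ge0 ?(ltW b0).
have q0 : 0 <= - B y y by apply: le_trans yb; rewrite mulr_ge0 ?hform_ge0 ?(ltW b0).
have D0 : 0 <= D by rewrite addr_ge0.
have test : e * D <= reform (S f - r%:C *: f) (s%:C *: (h - y)).
  rewrite -form_test fE.
  have -> : S (h + y) = S h + S y.
    by have := frame_opL hM hM' SE 1 h y; rewrite !scale1r.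
  rewrite !(symformE bS) hy0 yh0 (symformC bS y h).
  have := hk h Uh; have := hk' y Uy.
  have : e * B h h <= (k - r) * B h h by rewrite ler_wpM2r// ge_min lexx.
  have : e * - B y y <= (k' - r) * - B y y by rewrite ler_wpM2r// ge_min lexx orbT.
  rewrite /D; lra.
rewrite -(hform_sign (h - y)) in vb; rewrite -fE in fb.
exact: (test_vector_bound D0 b0 e0 fb vb test).
Qed.

(** Testing (S - r) (h + m) against m - h, where h and m are the components in
    ker U' and in its orthogonal complement M'. *)
Lemma bounded_below_real_gt (k k' r : R) : k < r -> k' < r ->
  (forall h, U' h = 0 -> B (S h) h <= k * B h h) ->
  (forall m, M' m -> reform (U' m) m <= k' * - B m m) ->
  bounded_below_shift S r%:C.
Proof.
move=> rk rk' hk hk'.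
have [b1 b10 hb1] := side_ker_definite hM'; have [b2 b20 hb2] := side_pos hM'.
pose b := Num.min b1 b2; have b0 : 0 < b by rewrite lt_min b10.
pose e := Num.min (r - k) (r - k').
have e0 : 0 < e by rewrite lt_min !subr_gt0 rk.
exists ((e * b / 2) ^+ 2) => [|f]; first by rewrite exprn_gt0// divr_gt0// mulr_gt0.
have [m Mm Uh] := side_proj hM' f; set h := f - m in Uh.
have hb : b * hform h h <= B h h.
  apply: (@le_trans _ _ (b1 * hform h h)); first by rewrite ler_wpM2r ?hform_ge0// ge_min lexx.
  by have := hb1 h Uh; rewrite mulNr opprK.
have yb : b * hform m m <= - B m m.
  rewrite /B -mulNr; apply: le_trans (hb2 m Mm).
  by rewrite ler_wpM2r ?hform_ge0// ge_min lexx orbT.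
have [fb vb] := hform_sum_le b0 hb yb.
have fE : f = h + m by rewrite /h subrK.
clearbody h.
have hm0 : B h m = 0 by rewrite /B (side_ker_orth hM' Uh Mm) mulr0.
have SC : B (S m) h = B (S h) m.
  by rewrite /B (frame_op_sym hM hM' SE) (symformC rS).
have Sm : B (S m) m = reform (U m) m - reform (U' m) m.
  rewrite /B SE (symformZl rS) mulrA -expr2 (side_sign hM) mul1r.
  by rewrite (symformDl rS) (symformNl rS).
set D := B h h + - B m m in fb vb.
have p0 : 0 <= B h h by apply: le_trans hb; rewrite mulr_ge0 ?hform_ge0 ?(ltW b0).
have q0 : 0 <= - B m m by apply: le_trans yb; rewrite mulr_ge0 ?hform_ge0 ?(ltW b0).
have D0 : 0 <= D by rewrite addr_ge0.
have test : e * D <= reform (S f - r%:C *: f) (s%:C *: (m - h)).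
  rewrite -form_test fE.
  have -> : S (h + m) = S h + S m.
    by have := frame_opL hM hM' SE 1 h m; rewrite !scale1r.
  rewrite !(symformE bS) SC (symformC bS m h) hm0 Sm.
  have := hk h Uh; have := hk' m Mm; have := side_ge0 hM m.
  have : e * B h h <= (r - k) * B h h by rewrite ler_wpM2r// ge_min lexx.
  have : e * - B m m <= (r - k') * - B m m by rewrite ler_wpM2r// ge_min lexx orbT.
  rewrite /D; lra.
rewrite hformB -(hform_sign (m - h)) in vb; rewrite -fE in fb.
exact: (test_vector_bound D0 b0 e0 fb vb test).
Qed.

End Real_shifts.

(** * Nonreal shifts *)

Section Nonreal_shifts.
Variables (R : realType) (H : kreinSpace R).

(** The second and fourth equations force a - d to be small, and the sum of the first
    and third says P + Q = 2 r a up to a small error. When 2 r a <= k a <= P this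
    makes Q small, hence also d, a and P; the case 2 r <= k' is symmetric. *)
Lemma pair_estimate (r s k k' : R) : s != 0 -> 0 < k -> 0 < k' ->
  2 * r <= k \/ 2 * r <= k' ->
  exists2 K : R, 0 < K & forall P Q a d w w' e1 e2 e3 e4 : R,
    0 <= P -> 0 <= Q -> 0 <= a -> 0 <= d -> k * a <= P -> k' * d <= Q ->
    P + w - r * a = e1 -> w' - s * a = e2 ->
    Q - w - r * d = e3 -> w' - s * d = e4 ->
    P + Q + (a + d) <= K * (`|e1| + `|e2| + `|e3| + `|e4|).
Proof.
move=> s0; wlog: k k' / 2 * r <= k => [W|rk] k0 k'0.
  case=> [rk|rk'].
    by have [|K K0 hK] := W k k' rk k0 k'0; [left|exists K].
  have [|K K0 hK] := W k' k rk' k'0 k0; [by left|exists K => //].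
  move=> P Q a d w w' e1 e2 e3 e4 P0 Q0 a0 d0 kP kQ E1 E2 E3 E4.
  have := hK Q P d a (- w) w' e3 e4 e1 e2 Q0 P0 d0 a0 kQ kP E3 E4.
  rewrite opprK => /(_ E1 E2); rewrite (addrC Q) (addrC d).
  by have -> : `|e3| + `|e4| + `|e1| + `|e2| = `|e1| + `|e2| + `|e3| + `|e4| by ring.
move=> _; pose T := `|s|^-1; pose K0 := 1 + `|r| * T.
have s1 : 0 < `|s| by rewrite normr_gt0.
have T0 : 0 < T by rewrite invr_gt0.
have K00 : 0 < K0 by rewrite /K0 ltr_wpDr// mulr_ge0// ltW.
pose L := K0 / k'; have L0 : 0 < L by rewrite divr_gt0.
exists (K0 + L + (L + T) + (`|r| * (2 * L + T) + 1)) => [|P Q a d w w' e1 e2 e3 e4].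
  have : 0 <= `|r| * (2 * L + T) by apply: mulr_ge0 => //; lra.
  lra.
move=> P0 Q0 a0 d0 kP kQ E1 E2 E3 E4.
set E := `|e1| + `|e2| + `|e3| + `|e4|.
have [n1 n2 n3 n4] : [/\ 0 <= `|e1|, 0 <= `|e2|, 0 <= `|e3| & 0 <= `|e4|] by [].
have E0 : 0 <= E by rewrite !addr_ge0.
have ad : `|a - d| <= T * E.
  have : `|s * (a - d)| <= E.
    have -> : s * (a - d) = e4 - e2 by rewrite -E2 -E4; ring.
    by apply: le_trans (ler_normB _ _) _; rewrite /E; lra.
  by rewrite normrM mulrC -ler_pdivlMr// mulrC.
have [l1 l3] := (ler_norm e1, ler_norm e3).
have rad : r * (d - a) <= `|r| * (T * E).
  apply: le_trans (ler_norm _) _; rewrite normrM ler_wpM2l// distrC.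
  exact: ad.
have ra : 2 * r * a <= P by apply: le_trans kP; rewrite ler_wpM2r.
have QE : Q <= K0 * E.
  have : P + Q = 2 * r * a + r * (d - a) + e1 + e3 by rewrite -E1 -E3; ring.
  have -> : K0 * E = E + `|r| * (T * E) by rewrite /K0; ring.
  move: rad ra; rewrite /E; lra.
have dE : d <= L * E.
  by rewrite /L mulrAC ler_pdivlMr// mulrC (le_trans kQ).
have aE : a <= (L + T) * E by rewrite mulrDl; have := ler_norm (a - d); lra.
have PE : P <= (`|r| * (2 * L + T) + 1) * E.
  have h : r * (a + d) <= `|r| * ((2 * L + T) * E).
    apply: le_trans (ler_norm _) _; rewrite normrM ler_wpM2l//.
    rewrite ger0_norm ?addr_ge0//; lra.
  have : P + Q = r * (a + d) + e1 + e3 by rewrite -E1 -E3; ring.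
  have -> : (`|r| * (2 * L + T) + 1) * E = `|r| * ((2 * L + T) * E) + E by ring.
  move: h; rewrite /E; lra.
lra.
Qed.

Let rS := @reform_sym R H.

(** The vectors (X, Y, Z, W) are (h, y, S h, S y) or (S h, S y, h, y), where h and
    y are the components of a vector in the kernels of the two parts of S. *)
Lemma pair_bounded_below (mu : R[i]) (k k' C : R) :
  complex.Im mu != 0 -> 0 < k -> 0 < k' -> 0 < C ->
  2 * complex.Re mu <= k \/ 2 * complex.Re mu <= k' ->
  exists2 c : R, 0 < c & forall X Y Z W : H,
    let D := reform X X + - reform Y Y + (reform Z X + - reform W Y) in
    0 <= reform X X -> 0 <= - reform Y Y -> 0 <= reform Z X -> 0 <= - reform W Y ->
    k * reform Z X <= reform X X -> k' * - reform W Y <= - reform Y Y ->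
    imform Z X = 0 -> imform W Y = 0 -> kform Z Y = 0 -> kform W X = 0 ->
    hform X X + hform Y Y <= C * D ->
    c * D <= hform (X + Y - mu *: (Z + W)) (X + Y - mu *: (Z + W)).
Proof.
move=> s0 k0 k'0 C0 rk; have [K K0 hK] := pair_estimate s0 k0 k'0 rk.
exists ((K * (8 * C))^-1 * K^-1) => [|X Y Z W D P0 Q0 a0 d0 kP kQ iZX iWY ZY WX hC].
  by rewrite divr_gt0// invr_gt0 !mulr_gt0.
set g := X + Y - _.
have zy : reform Z Y = 0 by rewrite /reform ZY.
have zy' : imform Z Y = 0 by rewrite /imform ZY.
have wx : reform W X = 0 by rewrite /reform WX.
have wx' : imform W X = 0 by rewrite /imform WX.
have iXX (V : H) : imform V V = 0 by rewrite /imform kform_real.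
have D0 : 0 <= D by rewrite !addr_ge0.
set r := complex.Re mu in hK; set s := complex.Im mu in hK.
have E1 : reform X X + reform Y X - r * reform Z X = reform g X.
  rewrite /g (symformDl rS) (symformNl rS) (symformDl rS) reformZl (symformDl rS).
  by rewrite imformDl iZX wx wx' -/r -/s; ring.
have E2 : imform Y X - s * reform Z X = imform g X.
  rewrite /g !imformDl imformNl imformZl imformDl (symformDl rS).
  by rewrite iZX wx wx' iXX -/r -/s; ring.
have E3 : - reform Y Y - reform Y X - r * - reform W Y = - reform g Y.
  rewrite /g (symformDl rS) (symformNl rS) (symformDl rS) reformZl (symformDl rS).
  by rewrite imformDl iWY zy zy' (symformC rS X Y) -/r -/s; ring.
have E4 : imform Y X - s * - reform W Y = - imform g Y.
  rewrite /g !imformDl imformNl imformZl imformDl (symformDl rS).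
  by rewrite iWY zy zy' iXX (imformC X Y) -/r -/s; ring.
have := hK _ _ _ _ _ _ _ _ _ _ P0 Q0 a0 d0 kP kQ E1 E2 E3 E4.
rewrite !normrN -/D; set e1 := `|_|; set e2 := `|imform g X|.
set e3 := `|reform g Y|; set e4 := `|imform g Y| => DE.
have g0 := hform_ge0 g.
have q1 : e1 ^+ 2 <= hform g g * hform X X.
  by rewrite /e1 -normrX ger0_norm ?sqr_ge0// reform_CauchySchwarz.
have q2 : e2 ^+ 2 <= hform g g * hform X X.
  by rewrite /e2 -normrX ger0_norm ?sqr_ge0// imform_CauchySchwarz.
have q3 : e3 ^+ 2 <= hform g g * hform Y Y.
  by rewrite /e3 -normrX ger0_norm ?sqr_ge0// reform_CauchySchwarz.
have q4 : e4 ^+ 2 <= hform g g * hform Y Y.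
  by rewrite /e4 -normrX ger0_norm ?sqr_ge0// imform_CauchySchwarz.
have sq4 : (e1 + e2 + e3 + e4) ^+ 2 <= 8 * C * hform g g * D.
  have : (e1 + e2 + e3 + e4) ^+ 2 <= 4 * (e1 ^+ 2 + e2 ^+ 2 + e3 ^+ 2 + e4 ^+ 2).
    rewrite -subr_ge0.
    have -> : 4 * (e1 ^+ 2 + e2 ^+ 2 + e3 ^+ 2 + e4 ^+ 2) - (e1 + e2 + e3 + e4) ^+ 2 =
      (e1 - e2) ^+ 2 + (e1 - e3) ^+ 2 + (e1 - e4) ^+ 2 + (e2 - e3) ^+ 2 +
      (e2 - e4) ^+ 2 + (e3 - e4) ^+ 2 by ring.
    by rewrite !addr_ge0 ?sqr_ge0.
  have := ler_wpM2l g0 hC; lra.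
have : K^-1 ^+ 2 * D <= 8 * C * hform g g.
  apply: ler_of_sqr => //; first by rewrite !mulr_ge0// ltW.
  rewrite [leRHS]mulrC; apply: le_trans sq4.
  have n0 : [/\ 0 <= e1, 0 <= e2, 0 <= e3 & 0 <= e4] by split; exact: normr_ge0.
  have [n1 n2 n3 n4] := n0.
  rewrite ler_pXn2r// ?nnegrE ?addr_ge0 ?mulr_ge0 ?invr_ge0 ?(ltW K0)//.
  by rewrite ler_pdivrMl.
have -> : (K * (8 * C))^-1 * K^-1 * D = (8 * C)^-1 * (K^-1 ^+ 2 * D).
  by field; rewrite !gt_eqF.
by move=> h; rewrite ler_pdivrMl// mulr_gt0.
Qed.

End Nonreal_shifts.

(** * Shifts of the frame operator *)

Section Spectrum_of_the_frame_operator.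
Variables (R : realType) (H : kreinSpace R).
Variables (M1 M2 : set H) (U1 U2 S : H -> H).
Hypothesis hM1 : frame_side 1 M1 U1.
Hypothesis hM2 : frame_side (-1) M2 U2.
Hypothesis SE : forall x, S x = U1 x - U2 x.
Implicit Types (f h x y : H) (l : R[i]).

Let rS := @reform_sym R H.

Lemma frame_opE1 x : S x = 1%:C *: (U1 x - U2 x).
Proof. by rewrite SE rmorph1 scale1r. Qed.

Lemma frame_opE2 x : S x = (-1)%:C *: (U2 x - U1 x).
Proof. by rewrite SE rmorphN1 scaleN1r opprB. Qed.

Lemma frame_side_NN : frame_side (- -1) M1 U1.
Proof. by rewrite opprK. Qed.

Lemma frame_op_imform x : imform (S x) x = 0.
Proof.
have : imform (S x) x = - imform (S x) x.
  by rewrite {1}imformC /imform (frame_op_kform hM1 hM2 frame_opE1).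
lra.
Qed.

Lemma resolvent_shift l : bounded_below_shift S l ->
  bounded_below_shift S (Num.conj l) -> resolvent_set S l.
Proof.
move=> [c c0 hc] [c' c'0 hc'].
have [C C0 hC] := frame_op_bounded hM1 hM2 frame_opE1.
apply: (@resolvent_of_bounded_below _ _ S C (Num.min c c')) => //.
- exact: (frame_opL hM1 hM2 frame_opE1).
- exact: (frame_op_sym hM1 hM2 frame_opE1).
- exact: ltW.
- by rewrite lt_min c0.
- by move=> x; apply: le_trans (hc x); rewrite ler_wpM2r ?hform_ge0// ge_min lexx.
- by move=> x; apply: le_trans (hc' x); rewrite ler_wpM2r ?hform_ge0// ge_min lexx orbT.
Qed.

Lemma kernels_definite : exists2 b : R, 0 < b & forall h y, U2 h = 0 -> U1 y = 0 ->
  b * (hform h h + hform y y) <= reform h h + - reform y y.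
Proof.
have [b1 b10 hb1] := side_ker_definite hM2; have [b2 b20 hb2] := side_ker_definite hM1.
exists (Num.min b1 b2) => [|h y /hb1 h1 /hb2 h2]; first by rewrite lt_min b10.
have : Num.min b1 b2 * hform h h <= b1 * hform h h.
  by rewrite ler_wpM2r ?hform_ge0// ge_min lexx.
have : Num.min b1 b2 * hform y y <= b2 * hform y y.
  by rewrite ler_wpM2r ?hform_ge0// ge_min lexx orbT.
lra.
Qed.

Lemma kernel_pos h : U2 h = 0 -> 0 <= reform h h.
Proof. by move/(kernel_ge0 hM2); rewrite mul1r. Qed.

Lemma kernel_neg y : U1 y = 0 -> 0 <= - reform y y.
Proof. by move/(kernel_ge0 frame_side_NN); rewrite mulN1r. Qed.

Lemma frame_op_pos h : U2 h = 0 -> 0 <= reform (S h) h.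
Proof.
move=> Uh; have := frame_op_form hM1 frame_opE1 h Uh; rewrite mul1r => ->.
exact: (side_ge0 hM1).
Qed.

Lemma frame_op_neg y : U1 y = 0 -> 0 <= - reform (S y) y.
Proof.
move=> Uy; have := frame_op_form hM2 frame_opE2 y Uy; rewrite mulN1r => ->.
exact: (side_ge0 hM2).
Qed.

(** The vector to be estimated is f - S f / l, tested against the components h and y
    of f in ker U2 and ker U1; its coefficient 1 / l is what the bound controls. *)
Lemma bounded_below_nonreal_dual (g1 g2 : R) l : complex.Im l != 0 -> 0 < g1 -> 0 < g2 ->
  (forall h, U2 h = 0 -> g1 * reform (S h) h <= reform h h) ->
  (forall y, U1 y = 0 -> g2 * - reform (S y) y <= - reform y y) ->
  2 * complex.Re l^-1 <= g1 \/ 2 * complex.Re l^-1 <= g2 ->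
  bounded_below_shift S l.
Proof.
move=> l0 g10 g20 hg1 hg2 hl.
have ln : l != 0 by apply: contra_neq l0 => ->.
have m0 : complex.Im l^-1 != 0.
  case: l l0 {hl ln} => a b /= b0.
  rewrite oppr_eq0 mulf_neq0// invr_neq0// paddr_eq0 ?sqr_ge0//.
  by rewrite negb_and !sqrf_eq0 b0 orbT.
have [b b0 hb] := kernels_definite.
have [c c0 hc] := pair_bounded_below H m0 g10 g20 (ltac:(by rewrite invr_gt0) : 0 < b^-1) hl.
have sl : 0 < sqmod l^-1.
  rewrite sqmodE ltr_wpDl ?sqr_ge0// exprn_even_gt0//.
exists ((sqmod l^-1)^-1 * (c * (b / 2))) => [|f].
  by rewrite mulr_gt0 ?invr_gt0// mulr_gt0// divr_gt0.
have [h Uh Uy] := frame_op_kernels hM1 hM2 frame_opE1 f; set y := f - h in Uy.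
have fE : f = h + y by rewrite /y addrC subrK.
clearbody y.
have SfE : S f = S h + S y.
  by rewrite fE; have := frame_opL hM1 hM2 frame_opE1 1 h y; rewrite !scale1r.
have p0 := kernel_pos Uh; have q0 := kernel_neg Uy.
have a0 := frame_op_pos Uh; have d0 := frame_op_neg Uy.
have hyb := hb h y Uh Uy.
have Sy : M2 (S y) by exact: (frame_op_ker_range hM2 frame_opE2).
have Sh : M1 (S h) by exact: (frame_op_ker_range hM1 frame_opE1).
have est := hc h y (S h) (S y) p0 q0 a0 d0 (hg1 h Uh) (hg2 y Uy)
  (frame_op_imform h) (frame_op_imform y).
have {}est := est ltac:(by rewrite kformC (side_ker_korth hM1 Uy Sh) rmorph0).
have {}est := est ltac:(by rewrite kformC (side_ker_korth hM2 Uh Sy) rmorph0).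
have {}est := est ltac:(by rewrite ler_pdivlMl//; lra).
have gE : hform (h + y - l^-1 *: (S h + S y)) (h + y - l^-1 *: (S h + S y)) =
    sqmod l^-1 * hform (S f - l *: f) (S f - l *: f).
  by rewrite -hformZ -fE -SfE scalerBr scalerA mulVf// scale1r hformB.
rewrite gE in est.
rewrite -mulrA ler_pdivrMl//; apply: le_trans est; rewrite -mulrA ler_wpM2l ?(ltW c0)//.
have fh : hform f f <= 2 * hform h h + 2 * hform y y by rewrite fE hform_sqrD.
have := ler_wpM2l (ltW b0) fh; lra.
Qed.

(** Here S f - l f is tested against S h and S y, the components of S f in M1
    and M2. *)
Lemma bounded_below_nonreal (k1 k2 : R) l : complex.Im l != 0 -> 0 < k1 -> 0 < k2 ->
  (forall m, M1 m -> k1 * reform m m <= reform (U1 m) m) ->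
  (forall m, M2 m -> k2 * - reform m m <= reform (U2 m) m) ->
  2 * complex.Re l <= k1 \/ 2 * complex.Re l <= k2 ->
  bounded_below_shift S l.
Proof.
move=> l0 k10 k20 hk1 hk2 hl.
have hk1' m : M1 m -> k1 * (1 * reform m m) <= reform (U1 m) m by rewrite mul1r; exact: hk1.
have hk2' m : M2 m -> k2 * (-1 * reform m m) <= reform (U2 m) m by rewrite mulN1r; exact: hk2.
have [b b0 hb] := kernels_definite.
have [a1 a10 ha1] := side_pos hM1; have [a2 a20 ha2] := side_pos hM2.
pose C := a1^-1 + a2^-1; have C0 : 0 < C by rewrite addr_gt0// invr_gt0.
have [c c0 hc] := pair_bounded_below H l0 k10 k20 C0 hl.
pose k := Num.min k1 k2; have k0 : 0 < k by rewrite lt_min k10.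
exists (c * (k * (b / 2))) => [|f]; first by rewrite !mulr_gt0// divr_gt0.
have [h Uh Uy] := frame_op_kernels hM1 hM2 frame_opE1 f; set y := f - h in Uy.
have fE : f = h + y by rewrite /y addrC subrK.
clearbody y.
have SfE : S f = S h + S y.
  by rewrite fE; have := frame_opL hM1 hM2 frame_opE1 1 h y; rewrite !scale1r.
have a0 := frame_op_pos Uh; have d0 := frame_op_neg Uy.
have hyb := hb h y Uh Uy.
have Sy : M2 (S y) by exact: (frame_op_ker_range hM2 frame_opE2).
have Sh : M1 (S h) by exact: (frame_op_ker_range hM1 frame_opE1).
have P0 := ha1 _ Sh; have Q0 := ha2 _ Sy; rewrite mul1r in P0; rewrite mulN1r in Q0.
have hSh := hform_ge0 (S h); have hSy := hform_ge0 (S y).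
have P0' : 0 <= reform (S h) (S h) by apply: le_trans P0; rewrite mulr_ge0// ltW.
have Q0' : 0 <= - reform (S y) (S y) by apply: le_trans Q0; rewrite mulr_ge0// ltW.
have aP := range_lower_bound hM1 frame_opE1 hk1' k10 Uh; rewrite !mul1r in aP.
have dQ := range_lower_bound hM2 frame_opE2 hk2' k20 Uy; rewrite !mulN1r in dQ.
have pa := kernel_lower_bound hM1 frame_opE1 hk1' (ltW k10) Uh; rewrite !mul1r in pa.
have qd := kernel_lower_bound hM2 frame_opE2 hk2' (ltW k20) Uy.
rewrite !mulN1r in qd.
have aE : reform h (S h) = reform (S h) h by rewrite (symformC rS).
have dE : reform y (S y) = reform (S y) y by rewrite (symformC rS).
have est := hc (S h) (S y) h y P0' Q0'; rewrite aE dE in est.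
have {}est := est a0 d0 aP dQ ltac:(by rewrite imformC frame_op_imform oppr0)
  ltac:(by rewrite imformC frame_op_imform oppr0)
  (side_ker_korth hM2 Uh Sy) (side_ker_korth hM1 Uy Sh).
have {}est : c * (reform (S h) (S h) - reform (S y) (S y) +
    (reform (S h) h - reform (S y) y)) <= hform (S f - l *: f) (S f - l *: f).
  rewrite SfE fE; apply: est.
  have h1 : hform (S h) (S h) <= a1^-1 * reform (S h) (S h) by rewrite ler_pdivlMl.
  have h2 : hform (S y) (S y) <= a2^-1 * - reform (S y) (S y) by rewrite ler_pdivlMl.
  have i1 : 0 <= a1^-1 by rewrite invr_ge0 ltW.
  have i2 : 0 <= a2^-1 by rewrite invr_ge0 ltW.
  rewrite /C; move: h1 h2 a0 d0 P0' Q0'.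
  move: (reform (S h) (S h)) (- reform (S y) (S y)) (reform (S h) h) (- reform (S y) y).
  move=> P Q a d h1 h2 a0 d0 P0' Q0'.
  have := mulr_ge0 i1 Q0'; have := mulr_ge0 i2 P0'.
  have := mulr_ge0 i1 (addr_ge0 a0 d0); have := mulr_ge0 i2 (addr_ge0 a0 d0); lra.
apply: le_trans est; rewrite -mulrA ler_wpM2l ?(ltW c0)//.
have fh : hform f f <= 2 * hform h h + 2 * hform y y by rewrite fE hform_sqrD.
have p0 := kernel_pos Uh; have q0 := kernel_neg Uy.
have h1 : k * reform h h <= k1 * reform h h by rewrite ler_wpM2r// ge_min lexx.
have h2 : k * - reform y y <= k2 * - reform y y by rewrite ler_wpM2r// ge_min lexx orbT.
have h3 : k * (b / 2 * hform f f) <= k * (reform h h + - reform y y).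
  rewrite ler_wpM2l ?(ltW k0)//; have := ler_wpM2l (ltW b0) fh; lra.
rewrite -mulrA; lra.
Qed.

End Spectrum_of_the_frame_operator.

(** * J-frames and their canonical duals *)

Section J_frame_sides.
Variables (R : realType) (H : kreinSpace R) (I : choiceType).
Variables (F : I -> H) (hF : bessel F).
Implicit Types (A : set I) (f h x y : H).

Lemma synthesis_closed_span A m : (synthesis F A @` @ell2 R I) m -> closed_span F A m.
Proof. by move=> [x x2 <-]; exact/adherent_closure/synthesis_adherent. Qed.

Lemma frame_side_of_bounds A (s c : R) : s ^+ 2 = 1 ->
  maximal_subspace (uniformly_definite s) (synthesis F A @` @ell2 R I) -> 0 < c ->
  (forall m, closed_span F A m ->
     ((c * (s * reform m m))%:E <= \esum_(i in A) (sqmod (kform m (F i)))%:E)%E) ->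
  frame_side s (synthesis F A @` @ell2 R I) (frame_part F A).
Proof.
move=> s1 hmax c0 hc; split=> //.
- exact: frame_partL.
- exact: frame_part_sym.
- by have [C C0 hC] := frame_part_bounded hF; exists C.
- exact: frame_part_ge0.
- exact: frame_part_range.
- exists c => // m /synthesis_closed_span/hc.
  by rewrite esum_frame_part// lee_fin.
Qed.

Variables (s : R) (A A' : set I).
Let M := synthesis F A @` @ell2 R I.
Let M' := synthesis F A' @` @ell2 R I.
Let U := frame_part F A.
Let U' := frame_part F A'.
Variable S : H -> H.
Hypothesis hM : frame_side s M U.
Hypothesis hM' : frame_side (- s) M' U'.
Hypothesis SE : forall x, S x = s%:C *: (U x - U' x).
Variable V : I -> H.
Hypothesis SV : forall i, S (V i) = F i.

Lemma frame_op_sum n (c : 'I_n -> R[i]) (v : 'I_n -> H) :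
  S (\sum_(k < n) c k *: v k) = \sum_(k < n) c k *: S (v k).
Proof.
have S0 : S 0 = 0 by have := frame_opB hM hM' SE 0 0; rewrite !subrr.
by elim/big_rec2: _ => // k x y _ <-; rewrite (frame_opL hM hM' SE).
Qed.

(** S h lies in M, hence is a limit of combinations of the F i; the inverse of S is
    bounded and maps them to combinations of the V i. *)
Lemma dual_closed_span h : U' h = 0 -> closed_span V A h.
Proof.
move=> Uh; apply: adherent_closure => e e0.
have [x x2 Sx] := frame_op_ker_range hM SE Uh.
have [c c0 low] := frame_op_bounded_below hM hM' SE.
have [_ [n [a [v [Fv ->]]]] hv] := synthesis_adherent hF A x2 (mulr_gt0 c0 e0).
pose i k := s2val (cid2 (Fv k)).
have iA k : A (i k) by exact: (s2valP (cid2 (Fv k))).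
have iF k : F (i k) = v k by exact: (s2valP' (cid2 (Fv k))).
exists (\sum_(k < n) a k *: V (i k)).
  by exists n, a, (fun k => V (i k)); split=> // k; exists (i k).
rewrite -(ltr_pM2l c0); apply: le_lt_trans (low _) _.
rewrite (frame_opB hM hM' SE) frame_op_sum -Sx.
by under eq_bigr do rewrite SV iF.
Qed.

Lemma dual_esum u : (\esum_(i in A) (sqmod (kform (S u) (V i)))%:E =
  (reform (U u) u)%:E)%E.
Proof.
rewrite -esum_frame_part//; apply: eq_esum => i _.
by rewrite (frame_op_kform hM hM' SE) SV.
Qed.

(** S maps ker U' onto M, which contains F i. *)
Lemma dual_ker i : A i -> U' (V i) = 0.
Proof.
move=> Ai; have FM : M (F i) by exact: synthesis_delta.
have [h Uh Sh] := frame_op_ker_onto hM hM' SE FM.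
by rewrite (_ : V i = h)//; apply: (frame_op_inj hM hM' SE); rewrite SV.
Qed.

End J_frame_sides.

Theorem corollary5p3 (R : realType) (H : kreinSpace R) (I : choiceType)
    (F : I -> H) (ap bp am bm gp dp gm dm : R)
    (hF : Jframe F)
    (hb : Jframe_bounds F ap bp am bm)
    (hap : 0 < ap) (habp : ap <= bp) (ham : 0 < am) (habm : am <= bm)
    (hd : Jframe_bounds (canonical_dual F) gp dp gm dm)
    (hgp : 0 < gp) (hgdp : gp <= dp) (hgm : 0 < gm) (hgdm : gm <= dm) :
  let em := Num.max (Num.min dp^-1 am) (Num.min dm^-1 ap) in
  let ep := Num.min (Num.max gp^-1 bm) (Num.max gm^-1 bp) in
  let a := Num.max ap am in
  let g := Num.max gp gm in
  spectrum (Jframe_op F) `&` real_line R `<=` [set r%:C | r in `[em, ep]] /\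
  spectrum (Jframe_op F) `\` real_line R `<=`
    [set l : R[i] | a / 2 < complex.Re l /\ `|l - (g^-1)%:C| < (g^-1)%:C].
Proof.
move=> em ep a g.
have [bF maxp maxm] := hF; have [[lop _ upp _] [lom _ upm _]] := hb.
have {}maxp := eq_maximal_subspace (@uniformly_positiveE R H) maxp.
have {}maxm := eq_maximal_subspace (@uniformly_negativeE R H) maxm.
set M1 := _ @` _ in maxp; set M2 := _ @` _ in maxm.
pose U1 := frame_part F (idx_pos F); pose U2 := frame_part F (idx_neg F).
have hM1 : frame_side 1 M1 U1.
  apply: (frame_side_of_bounds bF _ maxp hap); first by rewrite expr1n.
  by move=> m /lop; rewrite mul1r.
have hM2 : frame_side (-1) M2 U2.
  apply: (frame_side_of_bounds bF _ maxm ham); first by rewrite sqrrN expr1n.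
  by move=> m /lom; rewrite mulN1r.
have hM1' : frame_side (- -1) M1 U1 by rewrite opprK.
pose S := Jframe_op F; have SE x : S x = U1 x - U2 x by [].
have SE1 := frame_opE1 SE; have SE2 := frame_opE2 SE.
have SV i : S (canonical_dual F i) = F i.
  apply: (@surjpK _ _ _ _ [set: H]); last by rewrite in_setT.
  by move=> y _; have [x <-] := frame_op_onto hM1 hM2 SE1 y; exists x.
(* dual vectors lie in the kernels, where the form has the sign of their index set,
   so that the dual family splits along the same index sets *)
have real_pos (V : I -> H) i : idx_pos V i <-> 0 <= reform (V i) (V i).
  by rewrite /idx_pos /= kform_real ler0c.
have real_neg (V : I -> H) i : idx_neg V i <-> reform (V i) (V i) < 0.
  by rewrite /idx_neg /= kform_real -[0]/(0%:C) ltcR.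
have dpos i : idx_pos F i -> 0 <= reform (canonical_dual F i) (canonical_dual F i).
  by move=> Fi; apply: (kernel_pos hM2); apply: (dual_ker bF hM1 hM2 SE1 SV).
have dneg i : idx_neg F i -> reform (canonical_dual F i) (canonical_dual F i) < 0.
  move=> Fi; have U0 := dual_ker bF hM2 hM1' SE2 SV Fi.
  have [b b0 hker] := side_ker_definite hM1.
  have := hker _ U0; rewrite mul1r.
  suff : 0 < hform (canonical_dual F i) (canonical_dual F i).
    move=> /(mulr_gt0 b0); lra.
  rewrite lt_def hform_ge0 andbT; apply/negP => /eqP/hform_eq0 V0.
  move/real_neg: Fi; rewrite -(SV i) V0.
  have -> : S 0 = 0 by have := frame_opB hM1 hM2 SE1 0 0; rewrite !subrr.
  by rewrite (symform0l (@reform_sym R H)) ltxx.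
have posE : idx_pos (canonical_dual F) = idx_pos F.
  apply/seteqP; split=> i; last by move/dpos/real_pos.
  move/real_pos => h; apply/real_pos; rewrite leNgt; apply/negP => /real_neg/dneg.
  by rewrite ltNge h.
have negE : idx_neg (canonical_dual F) = idx_neg F.
  apply/seteqP; split=> i; last by move/dneg/real_neg.
  move/real_neg => h; apply/real_neg; rewrite ltNge; apply/negP => /real_pos/dpos.
  by rewrite leNgt h.
move: hd; rewrite /Jframe_bounds posE negE => -[[dlop _ dupp _] [dlom _ dupm _]].
have hdp : 0 < dp by apply: lt_le_trans hgdp.
have hdm : 0 < dm by apply: lt_le_trans hgdm.
have spanp f : U2 f = 0 -> closed_span (canonical_dual F) (idx_pos F) f.
  exact: (dual_closed_span bF hM1 hM2 SE1 SV).
have spanm f : U1 f = 0 -> closed_span (canonical_dual F) (idx_neg F) f.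
  exact: (dual_closed_span bF hM2 hM1' SE2 SV).
have lowp m : M1 m -> ap * reform m m <= reform (U1 m) m.
  by move=> /(synthesis_closed_span bF)/lop; rewrite esum_frame_part// lee_fin.
have uppp m : M1 m -> reform (U1 m) m <= bp * reform m m.
  by move=> /(synthesis_closed_span bF)/upp; rewrite esum_frame_part// lee_fin.
have lowm m : M2 m -> am * - reform m m <= reform (U2 m) m.
  by move=> /(synthesis_closed_span bF)/lom; rewrite esum_frame_part// lee_fin.
have uppm m : M2 m -> reform (U2 m) m <= bm * - reform m m.
  by move=> /(synthesis_closed_span bF)/upm; rewrite esum_frame_part// lee_fin.
have a_p h : U2 h = 0 -> ap * reform h h <= reform (S h) h.
  move=> Uh; have lowp' m : M1 m -> ap * (1 * reform m m) <= reform (U1 m) m.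
    by rewrite mul1r; exact: lowp.
  by have := kernel_lower_bound hM1 SE1 lowp' (ltW hap) Uh; rewrite !mul1r.
have a_m y : U1 y = 0 -> am * - reform y y <= - reform (S y) y.
  move=> Uy; have lowm' m : M2 m -> am * (-1 * reform m m) <= reform (U2 m) m.
    by rewrite mulN1r; exact: lowm.
  by have := kernel_lower_bound hM2 SE2 lowm' (ltW ham) Uy; rewrite !mulN1r.
have g_p h : U2 h = 0 -> gp * reform (S h) h <= reform h h.
  move=> Uh; have hg f u : U2 f = 0 -> S u = f -> gp * (1 * reform f f) <= reform (U1 u) u.
    move=> /spanp/dlop + Su; rewrite -Su (dual_esum bF hM1 hM2 SE1 SV) lee_fin.
    by rewrite mul1r.
  by have := dual_lower_bound hM1 hM2 SE1 hg hgp Uh; rewrite !mul1r.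
have g_m y : U1 y = 0 -> gm * - reform (S y) y <= - reform y y.
  move=> Uy; have hg f u : U1 f = 0 -> S u = f -> gm * (-1 * reform f f) <= reform (U2 u) u.
    move=> /spanm/dlom + Su; rewrite -Su (dual_esum bF hM2 hM1' SE2 SV) lee_fin.
    by rewrite mulN1r.
  by have := dual_lower_bound hM2 hM1' SE2 hg hgm Uy; rewrite !mulN1r.
have d_p h : U2 h = 0 -> reform h h <= dp * reform (S h) h.
  move=> Uh; have hg f u : U2 f = 0 -> S u = f -> reform (U1 u) u <= dp * (1 * reform f f).
    move=> /spanp/dupp + Su; rewrite -Su (dual_esum bF hM1 hM2 SE1 SV) lee_fin.
    by rewrite mul1r.
  by have := dual_upper_bound hM1 hM2 SE1 hg hdp Uh; rewrite !mul1r.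
have d_m y : U1 y = 0 -> - reform y y <= dm * - reform (S y) y.
  move=> Uy; have hg f u : U1 f = 0 -> S u = f -> reform (U2 u) u <= dm * (-1 * reform f f).
    move=> /spanm/dupm + Su; rewrite -Su (dual_esum bF hM2 hM1' SE2 SV) lee_fin.
    by rewrite mulN1r.
  by have := dual_upper_bound hM2 hM1' SE2 hg hdm Uy; rewrite !mulN1r.
have notres l : spectrum S l -> bounded_below_shift S l ->
    bounded_below_shift S (Num.conj l) -> False.
  by move=> sl b1 b2; apply: sl; exact: (resolvent_shift hM1 hM2 SE).
split.
  move=> l [sl [r _ rl]]; rewrite -rl in sl *; exists r => //.
  have conjr : Num.conj (r%:C) = r%:C :> R[i] by exact: conjc_real.
  have {}notres : bounded_below_shift S r%:C -> False.
    by move=> b1; apply: (notres _ sl b1); rewrite conjr.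
  rewrite /= in_itv /=; apply/andP; split; rewrite leNgt; apply/negP => hr.
    apply: notres.
    have below k k' : r < k -> r < k' ->
        (forall h, U2 h = 0 -> k * reform h h <= reform (S h) h) ->
        (forall y, U1 y = 0 -> k' * - reform y y <= - reform (S y) y) ->
        bounded_below_shift S r%:C.
      move=> rk rk' hk hk'; apply: (bounded_below_real_lt hM1 hM2 SE1 rk rk').
        by move=> h /hk; rewrite !mul1r.
      by move=> y /hk'; rewrite !mul1r.
    move: hr; rewrite /em lt_max !lt_min => /orP[] /andP[r1 r2].
      apply: below r1 r2 _ a_m => h /d_p; by rewrite ler_pdivrMl.
    by apply: below r2 r1 a_p _ => y /d_m; rewrite ler_pdivrMl.
  move: hr; rewrite /ep gt_min !gt_max => /orP[] /andP[r1 r2]; apply: notres.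
    apply: (bounded_below_real_gt hM1 hM2 SE1 r1 r2) => [h /g_p|m /uppm]; last by rewrite mul1r.
    by rewrite !mul1r ler_pdivlMl.
  apply: (bounded_below_real_gt hM2 hM1' SE2 r1 r2) => [h /g_m|m /uppp];
    last by rewrite mulN1r opprK.
  by rewrite !mulN1r ler_pdivlMl.
move=> l [sl nreal].
have l0 : complex.Im l != 0.
  apply/eqP => l0; apply: nreal; exists (complex.Re l) => //.
  by move: l0; case: (l) => x y /= ->.
have l0' : complex.Im (Num.conj l) != 0 by rewrite ImJ oppr_eq0.
have split_max (t u v : R) : t <= Num.max u v -> t <= u \/ t <= v.
  by rewrite le_max => /orP.
split; [rewrite ltNge|rewrite sqmod_norm_lt ?invr_gt0 ?lt_max ?hgp// ltNge];
  apply/negP => hl; apply: (notres _ sl).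
- apply: (bounded_below_nonreal hM1 hM2 SE l0 hap ham lowp lowm).
  by apply: split_max; rewrite -/a; lra.
- apply: (bounded_below_nonreal hM1 hM2 SE l0' hap ham lowp lowm).
  by rewrite ReJ; apply: split_max; rewrite -/a; lra.
all: have g0 : 0 < g by rewrite lt_max hgp.
all: have ReV : 2 * complex.Re l^-1 <= g.
1, 3: by apply: Re_inv_le.
- apply: (bounded_below_nonreal_dual hM1 hM2 SE l0 hgp hgm g_p g_m).
  exact: split_max.
- apply: (bounded_below_nonreal_dual hM1 hM2 SE l0' hgp hgm g_p g_m).
  by apply: split_max; rewrite -fmorphV ReJ.
Qed.
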